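(* Let $(p_n)_{n\in\mathbb{Z}}$ be a sequence of real numbers with $p_n\neq 0$ for all $n\in\mathbb{Z}$ and $\lim_{|n|\to\infty}p_n=0$. Let $\tilde{\mathbb{Z}}=\{n+p_n : n\in\mathbb{Z}\}$ and let $\alpha,\beta>0$. Then $\alpha\mathbb{Z}\times\beta\tilde{\mathbb{Z}}$ is a uniqueness set for the Gabor phase retrieval problem in $L^2(\mathbb{R}_+)$.
   Context: $\mathbb{R}_+=[0,\infty)$, and $L^2(\mathbb{R}_+)$ is regarded as the subspace of (complex-valued) functions in $L^2(\mathbb{R})$ vanishing almost everywhere outside $\mathbb{R}_+$. With $\varphi(t)=e^{-\pi t^2}$, the Gabor transform of $f\in L^2(\mathbb{R})$ is $\mathcal{G}f(x,\omega)=\int_{\mathbb{R}} f(t)\varphi(t-x)e^{-2\pi i\omega t}\,dt$ for $(x,\omega)\in\mathbb{R}^2$. Write $f\sim h$ if there is $\tau\in\mathbb{C}$, $|\tau|=1$, with $f=\tau h$ (equality almost everywhere). A set $\mathcal{U}\subseteq\mathbb{R}^2$ is a uniqueness set for the Gabor phase retrieval problem in $X\subseteq L^2(\mathbb{R})$ if for all $f,h\in X$: $|\mathcal{G}f(z)|=|\mathcal{G}h(z)|$ for all $z\in\mathcal{U}$ implies $f\sim h$. *)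

(* Defs.v *)
From HB Require Import structures.
From mathcomp Require Export all_boot all_order all_algebra.
From mathcomp Require Export all_classical all_reals all_analysis.
From mathcomp Require Export complex.

Set Implicit Arguments.
Unset Strict Implicit.
Unset Printing Implicit Defensive.

Import Order.TTheory GRing.Theory Num.Theory.
Import numFieldNormedType.Exports.

Local Open Scope classical_set_scope.
Local Open Scope ring_scope.
Local Open Scope complex_scope.

(* Complex-valued functions on the line are functions [R -> R[i]]; since [R[i]]
   carries no measurable structure, measurability and integration are taken
   componentwise.  [R] has its Borel sigma-algebra, which loses nothing: every
   a.e. class in L^2 has a Borel representative. *)

Section Gabor.
Context {R : realType}.

Local Notation mu := (@lebesgue_measure R).

Definition cmeasurable (f : R -> R[i]) : Prop :=
  measurable_fun [set: R] (fun t => complex.Re (f t)) /\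
  measurable_fun [set: R] (fun t => complex.Im (f t)).

Definition cintegral (f : R -> R[i]) : R[i] :=
  (\int[mu]_t complex.Re (f t)) +i* (\int[mu]_t complex.Im (f t)).

(* [complex.Re `|z|] is the modulus of [z] as an element of [R]. *)
Definition L2 : set (R -> R[i]) :=
  [set f | cmeasurable f /\ finite_norm mu 2%:E (fun t => complex.Re `|f t|)].

Definition L2_Rplus : set (R -> R[i]) :=
  [set f | L2 f /\ {ae mu, forall t, ~ `[0, +oo[%classic t -> f t = 0}].

Definition expi (x : R) : R[i] := cos x +i* sin x.

Definition gauss (t : R) : R := expR (- (pi * t ^+ 2)).

Definition gabor (f : R -> R[i]) (z : R * R) : R[i] :=
  cintegral (fun t => f t * (gauss (t - z.1))%:C * expi (- (2 * pi * z.2 * t))).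

Definition eq_up_to_phase (f h : R -> R[i]) : Prop :=
  exists2 tau : R[i], `|tau| = 1 & {ae mu, forall t, f t = tau * h t}.

Definition uniqueness_set (X : set (R -> R[i])) (U : set (R * R)) : Prop :=
  forall f h, X f -> X h ->
    (forall z, U z -> `|gabor f z| = `|gabor h z|) -> eq_up_to_phase f h.

End Gabor.

(* The filter "|n| --> oo" on the integers. *)
Definition int_oo : set_system int :=
  filter_from [set: nat] (fun N => [set n : int | (N <= `|n|)%N]).

#[global] Instance int_oo_filter : ProperFilter int_oo.
Proof.
apply: filter_from_proper; last by move=> N _; exists N%:Z => /=.
apply: filter_from_filter; first by exists 0%N.
move=> M N _ _; exists (maxn M N) => // n /=.
by rewrite geq_max => /andP[].
Qed.

Section Lattices.
Context {R : realType}.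

Definition Zset : set R := [set n%:~R | n in [set: int]].

Definition Ztilde (p : int -> R) : set R := [set n%:~R + p n | n in [set: int]].

Definition dilate (a : R) (A : set R) : set R := [set a * x | x in A].

End Lattices.

(* Main.v *)
(** With [b t = f t * gauss t], the moduli of the Gabor transform at the abscissas
    [- alpha * i], [i] in [nat], are Laplace moduli [|int b(t) expi(- 2 pi w t) expR(- k i t)|].
    Squared, they are moments in [expR(- k (t + s))], so by Weierstrass approximation
    they determine the products [F u * conj (F (- u - 4 pi w))] for all real [u], where
    [F] is the Fourier transform of a damped copy of [b]. Comparing two such
    transforms at consecutive frequencies [w_n], [w_(n+1)] gives [F = rho H] at the points
    [u + 4 pi (w_(n+1) - w_n)], which accumulate since [p] tends to [0] without vanishing.
    Both transforms are real analytic, hence [F = rho H] everywhere. *)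

(* For [t >= 0] the variable [W = expR (- k t)] stays in [[0, 1]]: this is what support in the
   half-line buys, and why the abscissas are taken nonpositive. The kernel to be approximated,
   [expR (- 2 k t) expi (t y)], is [W ^ 2] times a function of [ln W] that oscillates at [W = 0].
   The damping makes it Lipschitz up to [0], and is divided out again at the end. Only Lipschitz
   functions have to be approximated, so Bernstein polynomials with an explicit variance estimate
   suffice.

   A squared modulus shows the phase of [F] only through products of two of its values. A ratio can
   be extracted where neither factor vanishes, for all frequencies [w_n] simultaneously; Baire
   category provides such a [u].

   Analyticity enters through moments. By Rolle, accumulating zeros of the real and imaginary parts
   of a transform force all derivatives there, hence all moments of the modulated function, to
   vanish. Superexponential decay allows the exponential series to be summed under the integral, so
   the Laplace transform vanishes and the function is null. *)
Require Import Defs.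
From mathcomp Require Import ring lra measurable_realfun.
Import Order.TTheory GRing.Theory Num.Theory.
Import numFieldNormedType.Exports.

Set Implicit Arguments.
Unset Strict Implicit.
Unset Printing Implicit Defensive.

Local Open Scope classical_set_scope.
Local Open Scope ring_scope.
Local Open Scope complex_scope.

(** * Bernstein approximation of Lipschitz functions *)

Section Bernstein.
Context {R : realType}.

(* De Casteljau's recursion: evaluates at [x] to the expectation of [phi k] for
   [k] binomial with parameters [n] and [x]. *)
Fixpoint bernstein (n : nat) (phi : nat -> R) : {poly R} :=
  if n is m.+1 then
    'X * bernstein m (fun k => phi k.+1) + (1 - 'X) * bernstein m phi
  else (phi 0%N)%:P.

Lemma bernstein_le n (phi psi : nat -> R) x : 0 <= x <= 1 ->
  (forall k, (k <= n)%N -> phi k <= psi k) ->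
  (bernstein n phi).[x] <= (bernstein n psi).[x].
Proof.
move=> /andP[x0 x1]; elim: n phi psi => [|n IH] phi psi le_phi /=.
  by rewrite !hornerC le_phi.
rewrite !hornerE; apply: lerD; apply: ler_wpM2l => //.
- by apply: IH => k kn; exact: le_phi.
- by rewrite subr_ge0.
- by apply: IH => k kn; apply: le_phi; exact: leqW.
Qed.

(** Binomial mean [n x] and variance [n x (1 - x)]. The free centre [c] absorbs the shift [k.+1] of
    the recursion as [c - 1]. *)
Lemma bernstein_quadratic n x a b c :
  (bernstein n (fun k => a + b * (k%:R - c) ^+ 2)).[x] =
  a + b * (n%:R * x * (1 - x) + (n%:R * x - c) ^+ 2).
Proof.
elim: n c => [|n IH] c /=; first by rewrite hornerC; ring.
have -> : (fun k : nat => a + b * (k.+1%:R - c) ^+ 2) =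
          (fun k : nat => a + b * (k%:R - (c - 1)) ^+ 2).
  by apply/funext => k; rewrite -natr1; ring.
by rewrite !hornerE !IH -natr1; ring.
Qed.

(** Chebyshev's argument with a quadratic majorant: [|z| <= d + z ^ 2 / d] turns the Lipschitz bound
    at [k / n] into a quadratic in [k], whose binomial average is known exactly; monotonicity of the
    average transfers the comparison. *)
Lemma lipschitz_poly_approx (g : R -> R) (L : R) :
  (forall x y : R, 0 <= x <= 1 -> 0 <= y <= 1 -> `|g x - g y| <= L * `|x - y|) ->
  forall e : R, 0 < e -> exists P : {poly R},
    forall x : R, 0 <= x <= 1 -> `|g x - P.[x]| <= e.
Proof.
move=> lip e e0.
have L0 : 0 <= L.
  have := lip 1 0; rewrite subr0 normr1 mulr1 => H.
  apply: le_trans (normr_ge0 _) (H _ _); last by rewrite lexx ler01.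
  by rewrite lexx ler01.
(* Chosen so that the constant part [L d] of the majorant is at most [e / 2]; the [+ 1] covers
   [L = 0]. *)
pose d : R := e / (2 * (L + 1)).
have d0 : 0 < d by rewrite divr_gt0// mulr_gt0// ltr_wpDl.
have Ld : L * d <= e / 2.
  have L1 : 0 < L + 1 by rewrite ltr_wpDl.
  have -> : L * d = (L / (L + 1)) * (e / 2) by rewrite /d; field; rewrite gt_eqF.
  rewrite ler_piMl ?(divr_ge0 (ltW e0))//.
  by rewrite ler_pdivrMr ?mul1r ?lerDl.
clearbody d.
(* Makes the variance part [L x (1 - x) / (d n)] at most [e / 2]. *)
have [n nB] : exists n : nat, 2 * L / (e * d) < n%:R.
  by exists (Num.truncn (2 * L / (e * d))).+1; exact: truncnS_gt.
have n0 : (0 : R) < n%:R.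
  apply: le_lt_trans nB; rewrite divr_ge0//.
    by rewrite mulr_ge0.
  by rewrite mulr_ge0// ltW.
exists (bernstein n (fun k => g (k%:R / n%:R))) => x x01.
have key k : (k <= n)%N ->
    `|g (k%:R / n%:R) - g x| <= L * (d + (k%:R / n%:R - x) ^+ 2 / d).
  move=> kn; apply: le_trans (lip _ _ _ x01) _.
    by rewrite divr_ge0// ler_pdivrMr// mul1r ler_nat kn.
  apply: ler_wpM2l => //; set z := _ - x.
  have [zd|dz] := lerP `|z| d.
    by apply: le_trans zd _; rewrite lerDl divr_ge0// ?sqr_ge0// ltW.
  rewrite -[leLHS]add0r; apply: lerD; first exact: ltW.
  by rewrite ler_pdivlMr// -real_normK ?num_real// expr2 ler_pM// ltW.
have quad : L * d + L / (d * n%:R ^+ 2) * (n%:R * x * (1 - x) + (n%:R * x - n%:R * x) ^+ 2)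
    <= e.
  suff : L / (d * n%:R ^+ 2) * (n%:R * x * (1 - x) + (n%:R * x - n%:R * x) ^+ 2) <= e / 2.
    lra.
  rewrite subrr expr0n addr0.
  have -> : L / (d * n%:R ^+ 2) * (n%:R * x * (1 - x)) = L / (d * n%:R) * (x * (1 - x)).
    by field; rewrite !gt_eqF.
  have : L / (d * n%:R) <= e / 2.
    rewrite ler_pdivrMr ?mulr_gt0//.
    move: nB; rewrite ltr_pdivrMr ?mulr_gt0// => nB.
    lra.
  apply: le_trans; rewrite ler_piMr// ?divr_ge0// ?mulr_ge0// 1?ltW//.
  move: x01 => /andP[x0 x1]; nra.
rewrite distrC ler_norml lerNl opprB; apply/andP; split.
- rewrite lerBlDr -lerBlDl.
  have -> : g x - e = (bernstein n (fun k => (g x - e) + 0 * (k%:R - 0) ^+ 2)).[x].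
    by rewrite bernstein_quadratic; ring.
  apply: le_trans (_ : (bernstein n (fun k => (g x - L * d) +
     - (L / (d * n%:R ^+ 2)) * (k%:R - n%:R * x) ^+ 2)).[x] <= _).
    rewrite !bernstein_quadratic; move: quad; lra.
  apply: bernstein_le => // k /key; rewrite ler_norml => /andP[+ _].
  have -> : (k%:R / n%:R - x) ^+ 2 / d = (k%:R - n%:R * x) ^+ 2 / (d * n%:R ^+ 2).
    by field; rewrite !gt_eqF.
  lra.
- rewrite lerBlDl.
  apply: le_trans (_ : (bernstein n (fun k => (g x + L * d) +
     (L / (d * n%:R ^+ 2)) * (k%:R - n%:R * x) ^+ 2)).[x] <= _); last first.
    rewrite !bernstein_quadratic; move: quad; lra.
  apply: bernstein_le => // k /key; rewrite ler_norml => /andP[_].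
  have -> : (k%:R / n%:R - x) ^+ 2 / d = (k%:R - n%:R * x) ^+ 2 / (d * n%:R ^+ 2).
    by field; rewrite !gt_eqF.
  lra.
Qed.

End Bernstein.

(** * Functions on the half-line with superexponential decay *)

Section Decaying.
Context {R : realType}.
Local Notation mu := (@lebesgue_measure R).
Implicit Types p q k : R -> R.

(** A class stable under multiplication by polynomials, exponentials and trigonometric factors.
    Vanishing for negative [t] is required pointwise, so that multipliers need bounds only for
    [t >= 0]. *)
Definition decaying p : Prop :=
  [/\ measurable_fun [set: R] p, forall t : R, t < 0 -> p t = 0 &
      forall c : R, mu.-integrable [set: R] (EFin \o (fun t => p t * expR (c * t)))].

Definition exp_bounded k : Prop :=
  exists c C : R, forall t : R, 0 <= t -> `|k t| <= C * expR (c * t).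

Lemma measurable_expM (c : R) : measurable_fun [set: R] (fun t : R => expR (c * t)).
Proof. by apply: measurableT_comp => //; exact: measurable_funM. Qed.

Lemma decaying_integrable p : decaying p -> mu.-integrable [set: R] (EFin \o p).
Proof.
case=> _ _ /(_ 0); apply: eq_integrable => // t _.
by rewrite /= mul0r expR0 mulr1.
Qed.

Lemma decaying_norm p : decaying p -> decaying (fun t => `|p t|).
Proof.
case=> mp p0 ip; split; first exact: measurableT_comp.
  by move=> t /p0 ->; rewrite normr0.
move=> c; have /integrable_norm := ip c; apply: eq_integrable => // t _ /=.
by rewrite normrM (ger0_norm (expR_ge0 _)).
Qed.

Lemma decayingM p k : decaying p -> measurable_fun [set: R] k -> exp_bounded k ->
  decaying (fun t => p t * k t).
Proof.
move=> dp mk [c [C kb]]; have [mp p0 ip] := dp; split.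
- exact: measurable_funM.
- by move=> t /p0 ->; rewrite mul0r.
move=> d; have [_ _ /(_ (c + d)) ip'] := decaying_norm dp.
apply: (@le_integrable _ _ R mu [set: R] measurableT _
  (EFin \o (fun t => C * (`|p t| * expR ((c + d) * t))))).
- by apply/measurable_EFinP; apply: measurable_funM;
    [exact: measurable_funM|exact: measurable_expM].
- move=> t _; rewrite lee_fin; have [t0|t0] := ltP t 0.
    by rewrite p0// !mul0r normr0.
  have kt := kb t t0.
  rewrite [leRHS]ger0_norm; last first.
    rewrite mulrCA mulr_ge0// mulrDl expRD mulrA mulr_ge0 ?expR_ge0//.
    exact: le_trans kt.
  rewrite !normrM (ger0_norm (expR_ge0 _)) mulrDl expRD.
  rewrite mulrCA -mulrA ler_wpM2l// !mulrA ler_wpM2r ?expR_ge0//.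
- have := integrableZl measurableT C ip'.
  by apply: eq_integrable => // t _; rewrite /= EFinM.
Qed.

Lemma decayingD p q : decaying p -> decaying q -> decaying (fun t => p t + q t).
Proof.
move=> [mp p0 ip] [mq q0 iq]; split; first exact: measurable_funD.
  by move=> t t0; rewrite p0// q0// addr0.
move=> c; have := integrableD measurableT (ip c) (iq c).
by apply: eq_integrable => // t _; rewrite /= mulrDl EFinD.
Qed.

Lemma exp_bounded_cst k (C : R) : (forall t : R, 0 <= t -> `|k t| <= C) -> exp_bounded k.
Proof. by move=> kC; exists 0, C => t /kC; rewrite mul0r expR0 mulr1. Qed.

Lemma exp_bounded_exp (c : R) : exp_bounded (fun t => expR (c * t)).
Proof. by exists c, 1 => t _; rewrite mul1r ger0_norm ?expR_ge0. Qed.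

Lemma exp_bounded_id : exp_bounded id.
Proof.
exists 1, 1 => t t0; rewrite !mul1r ger0_norm//.
by apply: le_trans (expR_ge1Dx t); rewrite lerDr.
Qed.

Lemma exp_bounded_cos (y : R) : exp_bounded (fun t => cos (t * y)).
Proof.
by apply: (@exp_bounded_cst _ 1) => t _; rewrite ler_norml cos_geN1 cos_le1.
Qed.

Lemma exp_bounded_sin (y : R) : exp_bounded (fun t => sin (t * y)).
Proof.
by apply: (@exp_bounded_cst _ 1) => t _; rewrite ler_norml sin_geN1 sin_le1.
Qed.

Lemma exp_boundedM k l : exp_bounded k -> exp_bounded l -> exp_bounded (fun t => k t * l t).
Proof.
move=> [c [C kC]] [d [D lD]]; exists (c + d), (C * D) => t t0.
by rewrite normrM mulrDl expRD mulrACA ler_pM// ?kC ?lD.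
Qed.

Lemma exp_boundedN k : exp_bounded k -> exp_bounded (fun t => - k t).
Proof. by move=> [c [C kC]]; exists c, C => t t0; rewrite normrN kC. Qed.

Lemma decayingN p : decaying p -> decaying (fun t => - p t).
Proof.
move=> dp; have -> : (fun t => - p t) = (fun t => p t * -1).
  by apply/funext => t; rewrite mulrN1.
apply: decayingM => //; apply: (@exp_bounded_cst _ 1) => t _.
by rewrite normrN1.
Qed.

Lemma decayingX p n : decaying p -> decaying (fun t => p t * t ^+ n).
Proof.
move=> dp; elim: n => [|n IH].
  by move: dp; congr decaying; apply/funext => t; rewrite expr0 mulr1.
have -> : (fun t => p t * t ^+ n.+1) = (fun t => (p t * t ^+ n) * t).
  by apply/funext => t; rewrite exprSr mulrA.
by apply: decayingM => //; exact: exp_bounded_id.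
Qed.

Lemma decaying_Rintegral_le p k (e : R) : decaying p -> measurable_fun [set: R] k ->
  (forall t : R, 0 <= t -> `|k t| <= e) ->
  `|\int[mu]_t (p t * k t)| <= e * \int[mu]_t `|p t|.
Proof.
move=> dp mk ke; have dpk := decayingM dp mk (exp_bounded_cst ke).
apply: le_trans (le_normr_Rintegral _ _) _ => //; first exact: decaying_integrable.
have ip := decaying_integrable (decaying_norm dp).
rewrite -RintegralZl//; apply: le_Rintegral => //.
- exact: decaying_integrable (decaying_norm dpk).
- have := integrableZl measurableT e ip.
  by apply: eq_integrable => // t _; rewrite /= EFinM.
move=> t _; have [t0|t0] := ltP t 0.
  by have [_ -> // _] := dp; rewrite mul0r normr0 mulr0.
by rewrite normrM mulrC ler_wpM2r// ke.
Qed.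

Lemma decaying_dominated_cvg p (k_ : nat -> R -> R) k (c C : R) : decaying p ->
  (forall n, measurable_fun [set: R] (k_ n)) -> measurable_fun [set: R] k ->
  (forall n (t : R), 0 <= t -> `|k_ n t| <= C * expR (c * t)) ->
  (forall t : R, 0 <= t -> k_ n t @[n --> \oo] --> k t) ->
  \int[mu]_t (p t * k_ n t) @[n --> \oo] --> \int[mu]_t (p t * k t).
Proof.
move=> dp mk_ mk kb kk; have [mp p0 ip] := dp.
have [_ _ /(_ c) ip'] := decaying_norm dp.
have dpk : decaying (fun t => p t * k t).
  apply: decayingM => //; exists c, C => t t0.
  have kt : `|k_ n t| @[n --> \oo] --> `|k t| by apply: cvg_norm; exact: kk.
  rewrite -(cvg_lim _ kt)//; apply: limr_le; first by apply/cvg_ex; exists `|k t|.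
  by near=> n; exact: kb.
have := @dominated_convergence _ _ R mu [set: R] measurableT
  (fun n t => (p t * k_ n t)%:E) (fun t => (p t * k t)%:E)
  (fun t => (C * (`|p t| * expR (c * t)))%:E).
case.
- by move=> n; apply/measurable_EFinP; apply: (measurable_funM mp).
- by apply/measurable_EFinP; exact: measurable_funM.
- apply/aeW => t _; apply: cvg_EFin; first exact: nearW.
  have [t0|t0] := ltP t 0.
    rewrite p0// mul0r /comp /=; under eq_fun do rewrite mul0r.
    exact: cvg_cst.
  by apply: cvgMr; exact: kk.
- have := integrableZl measurableT C ip'.
  by apply: eq_integrable => // t _; rewrite /= EFinM.
- apply/aeW => t n _; rewrite lee_fin; have [t0|t0] := ltP t 0.
    by rewrite p0// mul0r normr0 mul0r mulr0.
  by rewrite normrM mulrCA ler_wpM2l// kb.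
move=> _ _ H; rewrite /Rintegral; apply: fine_cvg.
rewrite fineK//; apply: integrable_fin_num => //.
exact: decaying_integrable dpk.
Unshelve. all: end_near. Qed.

End Decaying.

(** * Determination by moments *)

Section Moments.
Context {R : realType}.
Local Notation mu := (@lebesgue_measure R).
Implicit Types p g : R -> R.

Lemma Rintegral_cst0 : \int[mu]_t (0 : R) = 0.
Proof. by rewrite /Rintegral integral0. Qed.

Lemma decaying_sum n (F : nat -> R -> R) : (forall i, decaying (F i)) ->
  decaying (fun t => \sum_(i < n) F i t) /\
  \int[mu]_t (\sum_(i < n) F i t) = \sum_(i < n) \int[mu]_t F i t.
Proof.
move=> dF; elim: n => [|n [IHd IH]].
  under eq_fun do rewrite big_ord0;
  rewrite big_ord0 Rintegral_cst0; split=> //; split=> // c.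
  by under eq_fun do rewrite mul0r; exact: integrable0.
under eq_fun do rewrite big_ord_recr;
rewrite big_ord_recr; split; first exact: decayingD.
by rewrite RintegralD ?IH//; exact: decaying_integrable.
Qed.

(** For [t >= 0] the partial sums of the exponential series at [c t] are bounded by [expR (|c| t)],
    which [p] absorbs, so dominated convergence applies. *)
Lemma decaying_moments_laplace p (c : R) : decaying p ->
  (forall j, \int[mu]_t (p t * t ^+ j) = 0) -> \int[mu]_t (p t * expR (c * t)) = 0.
Proof.
move=> dp mom.
have ms n : measurable_fun [set: R] (fun t : R => series (exp_coeff (c * t)) n).
  rewrite /series /=; apply: measurable_sum => i.
  by apply: measurable_funM => //; apply: measurable_funX; exact: measurable_funM.
have : \int[mu]_t (p t * series (exp_coeff (c * t)) n) @[n --> \oo] -->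
    \int[mu]_t (p t * expR (c * t)).
  apply: (@decaying_dominated_cvg _ _ _ _ `|c| 1) => //.
  - exact: measurable_expM.
  - move=> n t t0; rewrite mul1r.
    apply: le_trans (_ : series (exp_coeff (`|c| * t)) n <= _).
      rewrite -{2}(ger0_norm t0) -normrM -normed_series_exp_coeff.
      exact: ler_norm_sum.
    apply: nondecreasing_cvgn_le; last exact: is_cvg_series_exp_coeff.
    apply: nondecreasing_series => i _ _; apply: exp_coeff_ge0.
    by rewrite mulr_ge0.
  - by move=> t _; exact: is_cvg_series_exp_coeff.
have -> : (fun n => \int[mu]_t (p t * series (exp_coeff (c * t)) n)) = fun=> 0.
  apply/funext => n.
  pose F i (t : R) := p t * t ^+ i * (c ^+ i / i`!%:R).
  have dF i : decaying (F i).
    apply: decayingM; [exact: decayingX|by []|].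
    by apply: (@exp_bounded_cst _ _ `|c ^+ i / i`!%:R|) => t _.
  have [_] := decaying_sum n dF.
  rewrite big1 => [<-|i _]; last first.
    by rewrite /F RintegralZr ?mom ?mul0r//; exact/decaying_integrable/decayingX.
  apply: eq_Rintegral => t _; rewrite /series /= big_mkord mulr_sumr.
  by apply: eq_bigr => i _; rewrite /F /exp_coeff /= exprMn; ring.
by move=> H; rewrite -(cvg_unique (@norm_hausdorff _ R) H (cvg_cst _)).
Qed.

Lemma expRN_itv (t : R) : 0 <= t -> 0 <= expR (- t) <= 1.
Proof. by move=> t0; rewrite expR_ge0 -expR0 ler_expR oppr_le0. Qed.

Lemma measurable_expRN : measurable_fun [set: R] (fun t : R => expR (- t)).
Proof. by apply: measurableT_comp => //; exact: measurable_funN. Qed.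

(** [expR (- t)] maps the half-line into [[0, 1]], where [g] is a uniform limit of polynomials;
    polynomials in [expR (- t)] integrate to zero against [p]. *)
Lemma decaying_laplace_lipschitz p g (L : R) : decaying p ->
  (forall m : nat, \int[mu]_t (p t * expR (- m%:R * t)) = 0) ->
  measurable_fun [set: R] g ->
  (forall x y : R, 0 <= x <= 1 -> 0 <= y <= 1 -> `|g x - g y| <= L * `|x - y|) ->
  \int[mu]_t (p t * g (expR (- t))) = 0.
Proof.
move=> dp lap mg lip.
have mgE : measurable_fun [set: R] (fun t : R => g (expR (- t))).
  by apply: measurableT_comp => //; exact: measurable_expRN.
have gb : forall t : R, 0 <= t -> `|g (expR (- t))| <= `|g 0| + L.
  move=> t t0; have W01 := expRN_itv t0.
  have L0 : 0 <= L.
    have := lip 1 0; rewrite subr0 normr1 mulr1 => H.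
    by apply: le_trans (normr_ge0 _) (H _ _); rewrite lexx ler01.
  rewrite -[X in `|X|](subrK (g 0)) addrC; apply: le_trans (ler_normD _ _) _.
  rewrite lerD2l; apply: le_trans (lip _ _ W01 _) _; first by rewrite lexx ler01.
  by rewrite subr0; apply: ler_piMr => //; case/andP: W01 => ? ?; rewrite ger0_norm.
have dpg := decayingM dp mgE (exp_bounded_cst gb).
apply/eqP; rewrite -normr_eq0 eq_le normr_ge0 andbT.
set N := \int[mu]_t `|p t|.
have N0 : 0 <= N by exact: Rintegral_ge0.
apply/ler_addgt0Pr => e e0; rewrite add0r.
(* [N] is the L1 norm of [p]; [N + 1] keeps the quotient meaningful when [p] is null. *)
have [P gP] := lipschitz_poly_approx lip (divr_gt0 e0 (ltr_wpDl N0 ltr01)).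
have mP : measurable_fun [set: R] (fun t : R => P.[expR (- t)]).
  under eq_fun do rewrite horner_coef.
  apply: measurable_sum => i; apply: measurable_funM => //.
  by apply: measurable_funX; exact: measurable_expRN.
have Pb : forall t : R, 0 <= t -> `|g (expR (- t)) - P.[expR (- t)]| <= e / (N + 1).
  by move=> t /expRN_itv; exact: gP.
have mgP := measurable_funB mgE mP.
have dpgP := decayingM dp mgP (exp_bounded_cst Pb).
have intP : \int[mu]_t (p t * P.[expR (- t)]) = 0.
  pose F i (t : R) := p t * expR (- i%:R * t) * P`_i.
  have dpe i : decaying (fun t => p t * expR (- i%:R * t)).
    by apply: decayingM => //; [exact: measurable_expM|exact: exp_bounded_exp].
  have dF i : decaying (F i).
    apply: decayingM => //.
    by apply: (@exp_bounded_cst _ _ `|P`_i|) => t _.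
  have [_] := decaying_sum (size P) dF.
  rewrite big1 => [<-|i _]; last first.
    by rewrite /F RintegralZr ?lap ?mul0r//; exact: decaying_integrable.
  apply: eq_Rintegral => t _; rewrite horner_coef mulr_sumr.
  apply: eq_bigr => i _; rewrite /F -expRM_natl mulNr mulrN; ring.
have -> : \int[mu]_t (p t * g (expR (- t))) =
    \int[mu]_t (p t * (g (expR (- t)) - P.[expR (- t)])).
  rewrite -[RHS]addr0 -intP -RintegralD//.
  - by apply: eq_Rintegral => t _; ring.
  - exact: decaying_integrable.
  - have -> : (fun t => p t * P.[expR (- t)]) = (fun t => p t * g (expR (- t)) +
        - (p t * (g (expR (- t)) - P.[expR (- t)]))) by apply/funext => t; ring.
    by apply/decaying_integrable/decayingD => //; exact: decayingN.
apply: le_trans (decaying_Rintegral_le dp mgP Pb) _; rewrite -/N.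
rewrite -mulrA ler_piMr ?(ltW e0)// mulrC ler_pdivrMr ?ltr_wpDl//.
by rewrite mul1r lerDl.
Qed.

(* Clamped linear ramps in [expR (- t)] tend to the indicator of [t <= x]. *)
Lemma decaying_laplace_eq0 p : decaying p ->
  (forall m : nat, \int[mu]_t (p t * expR (- m%:R * t)) = 0) ->
  {ae mu, forall t, p t = 0}.
Proof.
move=> dp lap; have [mp p0 ip] := dp; have ipp := decaying_integrable dp.
(* Lebesgue differentiation: [p] is almost everywhere the derivative of its primitive from [-oo],
   here the zero function. *)
suff int0 x : \int[mu]_(t in `]-oo, x]) p t = 0.
  have loc : locally_integrable [set: R] p.
    by apply: open_integrable_locally => //; exact: openT.
  have := FTC1Ny _ loc => /(_ _).
  have ipy y : mu.-integrable `]-oo, y] (EFin \o p).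
    exact: integrableS ipp.
  move/(_ ipy); apply: filterS; first exact: (ae_filter_ringOfSetsType mu).
  move=> t [_ <-].
  rewrite (_ : (fun x => _) = cst 0); last by apply/funext => y; exact: int0.
  by rewrite derive1_cst.
(* Equal to [1] for [W >= expR (- x)], that is [t <= x], and for [n > 0] equal to [0] below
   [expR (- x) - 1 / n]; the slope [n] in between is the Lipschitz constant. *)
pose ramp n (W : R) : R := Num.min 1 (Num.max 0 (1 + n%:R * (W - expR (- x)))).
have ramp01 n W : `|ramp n W| <= 1.
  rewrite /ramp; set z := 1 + _; rewrite ger0_norm; first by rewrite ge_min lexx.
  by rewrite le_min ler01 le_max lexx.
have lip n (a b : R) : `|ramp n a - ramp n b| <= n%:R * `|a - b|.
  have n0 : (0 : R) <= n%:R by [].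
  rewrite /ramp; set u := 1 + _; set v := 1 + _.
  have -> : n%:R * `|a - b| = `|u - v|.
    by rewrite -[X in X * _](ger0_norm n0) -normrM; congr `|_|; rewrite /u /v; ring.
  have := ler_norm (u - v); have := ler_norm (v - u); rewrite distrC.
  rewrite ler_norml; move: `|u - v| => w; clearbody u v => vu uv.
  by case: (leP 0 u) => ?; case: (leP 0 v) => ?; case: (leP 1 u) => ?;
    case: (leP 1 v) => ?; case: (leP 1 (0 : R)) => ?; lra.
have mramp n : measurable_fun [set: R] (ramp n).
  apply: measurable_minr => //; apply: measurable_maxr => //.
  by apply: measurable_funD => //; apply: measurable_funM => //; exact: measurable_funB.
have : \int[mu]_t (p t * ramp n (expR (- t))) @[n --> \oo] -->
    \int[mu]_t (p t * \1_(`]-oo, x]%classic) t).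
  apply: (@decaying_dominated_cvg _ _ _ _ 0 1) => //.
  - move=> n; apply: measurableT_comp => //; exact: measurable_expRN.
  - by move=> n t _; rewrite mul0r expR0 mulr1.
  - move=> t t0; rewrite indicE; have [tx|xt] := leP t x.
      rewrite mem_set//=.
      have -> : (fun n => ramp n (expR (- t))) = fun=> 1.
        apply/funext => n; rewrite /ramp; apply/min_idPl.
        rewrite le_max; apply/orP; right; rewrite lerDl mulr_ge0// subr_ge0.
        by rewrite ler_expR lerN2.
      exact: cvg_cst.
    rewrite memNset /=; last by rewrite in_itv/=; apply/negP; rewrite -ltNge.
    apply: cvg_near_cst; near=> n; rewrite /ramp.
    have -> : Num.max 0 (1 + n%:R * (expR (- t) - expR (- x))) = 0 :> R.
      apply/max_idPl.
      have d0 : 0 < expR (- x) - expR (- t) by rewrite subr_gt0 ltr_expR ltrN2.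
      have : (expR (- x) - expR (- t))^-1 <= n%:R :> R.
        by near: n; exact: nbhs_infty_ger.
      by rewrite -[_^-1]mul1r ler_pdivrMr//; lra.
    by apply/min_idPr.
have -> : (fun n => \int[mu]_t (p t * ramp n (expR (- t)))) = fun=> 0.
  apply/funext => n; apply: (decaying_laplace_lipschitz dp lap (mramp n)).
  by move=> a b _ _; exact: lip.
move=> H; rewrite Rintegral_mkcond.
rewrite -(cvg_unique (@norm_hausdorff _ R) H (cvg_cst _)).
apply: eq_Rintegral => t _.
by rewrite patchE indicE; case: ifP => _; rewrite ?mulr1 ?mulr0.
Unshelve. all: end_near. Qed.

Lemma decaying_moments_eq0 p : decaying p ->
  (forall j, \int[mu]_t (p t * t ^+ j) = 0) -> {ae mu, forall t, p t = 0}.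
Proof.
by move=> dp mom; apply: decaying_laplace_eq0 => // m; exact: decaying_moments_laplace.
Qed.

End Moments.

(** * Accumulating zeros of Fourier transforms *)

Section Fourier.
Context {R : realType}.
Local Notation mu := (@lebesgue_measure R).
Implicit Types p q phi : R -> R.

(** The cluster point is fixed at [0], which is not itself counted as a zero; other points are
    brought to [0] by modulation. *)
Definition zeros_cluster phi : Prop :=
  forall e : R, 0 < e -> exists d : R, 0 < `|d| < e /\ phi d = 0.

Lemma zeros_cluster_eq0 phi : {for 0, continuous phi} -> zeros_cluster phi -> phi 0 = 0.
Proof.
move=> cphi acc; apply/eqP; rewrite -normr_eq0 eq_le normr_ge0 andbT.
apply/ler_addgt0Pr => e e0; rewrite add0r.
have /cvgrPdist_le/(_ _ e0)[r /= r0 H] := cphi.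
have [d [/andP[_ dr] pd0]] := acc _ r0.
by have := H d; rewrite /= sub0r normrN pd0 subr0; apply.
Qed.

(* Rolle's theorem between [0] and each zero. *)
Lemma zeros_cluster_derive phi (phi' : R -> R) :
  (forall y : R, is_derive y 1 phi (phi' y)) ->
  zeros_cluster phi -> zeros_cluster phi'.
Proof.
move=> dphi acc.
have dr y : derivable phi y 1 by have := dphi y; case.
have cphi y : {for y, continuous phi}.
  by apply: differentiable_continuous; exact/derivable1_diffP.
have phi0 := zeros_cluster_eq0 (cphi 0) acc.
have cw (a b : R) : {within `[a, b], continuous phi}.
  by apply: continuous_subspaceT => y; exact: cphi.
move=> e /acc [d [/andP[d0 de] pd0]].
have [c /andP[c0 cd] dc] : exists2 c : R, 0 < `|c| < `|d| & is_derive c 1 phi 0.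
  have [dlt0|dgt0|d00] := ltgtP d 0; last by rewrite d00 normr0 ltxx in d0.
  - have [x _||c + dc] := @Rolle R phi d 0 dlt0 _ (cw _ _).
    + exact: dr.
    + by rewrite pd0 phi0.
    + rewrite in_itv /= => /andP[dc1 c0]; exists c => //.
      by rewrite !ltr0_norm// oppr_gt0 c0 ltrN2.
  - have [x _||c + dc] := @Rolle R phi 0 d dgt0 _ (cw _ _).
    + exact: dr.
    + by rewrite pd0 phi0.
    + rewrite in_itv /= => /andP[c0 dc1]; exists c => //.
      by rewrite !gtr0_norm// c0.
exists c; rewrite c0 (lt_trans cd de); split => //.
have := dphi c; case=> _ <-; by case: dc.
Qed.

(* The real part of the transform of [p + i q]. *)
Definition re_fourier p q (y : R) : R := \int[mu]_t (p t * cos (t * y) - q t * sin (t * y)).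

Lemma decaying_cos p (y : R) : decaying p -> decaying (fun t => p t * cos (t * y)).
Proof.
move=> dp; apply: decayingM => //; last exact: exp_bounded_cos.
apply: (measurableT_comp (continuous_measurable_fun (@continuous_cos R))).
exact: measurable_funM.
Qed.

Lemma decaying_sin p (y : R) : decaying p -> decaying (fun t => p t * sin (t * y)).
Proof.
move=> dp; apply: decayingM => //; last exact: exp_bounded_sin.
apply: (measurableT_comp (continuous_measurable_fun (@continuous_sin R))).
exact: measurable_funM.
Qed.

Lemma decaying_re_fourier p q (y : R) : decaying p -> decaying q ->
  decaying (fun t => p t * cos (t * y) - q t * sin (t * y)).
Proof.
move=> dp dq; apply: decayingD; first exact: decaying_cos.
exact/decayingN/decaying_sin.
Qed.

Lemma decaying_id p : decaying p -> decaying (fun t => p t * t).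
Proof. by move=> dp; apply: decayingM => //; exact: exp_bounded_id. Qed.

(** The new pair consists of the components of [i t (p + i q)]; [|q t| + |p t|] dominates the
    differentiated integrand uniformly in the frequency. *)
Lemma is_derive_re_fourier p q (y : R) : decaying p -> decaying q ->
  is_derive y 1 (re_fourier p q) (re_fourier (fun t => - (q t * t)) (fun t => p t * t) y).
Proof.
move=> dp dq.
pose f (x t : R) := p t * cos (t * x) - q t * sin (t * x).
have df (x t : R) : is_derive x 1 (f ^~ t)
    (- (q t * t) * cos (t * x) - p t * t * sin (t * x)).
  rewrite /f; apply: is_derive_eq; rewrite /GRing.scale /=; ring.
have d1f (x t : R) : partial1of2 f x t = - (q t * t) * cos (t * x) - p t * t * sin (t * x).
  by rewrite partial1of2E; case: (df x t).
pose G (t : R) := `|q t * t| + `|p t * t|.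
have yI : `]y - 1, y + 1[%classic y by rewrite /= in_itv /=; apply/andP; split; lra.
have intf x : `]y - 1, y + 1[%classic x -> mu.-integrable [set: R] (EFin \o f x).
  by move=> _; exact/decaying_integrable/decaying_re_fourier.
have derf (x t : R) : `]y - 1, y + 1[%classic x -> [set: R] t -> derivable (f ^~ t) x 1.
  by move=> _ _; case: (df x t).
have G0 t : 0 <= G t by rewrite addr_ge0.
have intG : mu.-integrable [set: R] (EFin \o G).
  by apply/decaying_integrable/decayingD; exact/decaying_norm/decaying_id.
have Gub (x t : R) : `]y - 1, y + 1[%classic x -> [set: R] t -> `|partial1of2 f x t| <= G t.
  move=> _ _; rewrite d1f /G; apply: le_trans (ler_normB _ _) _.
  rewrite mulNr normrN !(normrM _ (cos _)) !(normrM _ (sin _)).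
  by apply: lerD; apply: ler_piMr => //; rewrite ler_norml ?cos_geN1 ?cos_le1 ?sin_geN1 ?sin_le1.
have := derivable_under_integral measurableT yI intf derf G0 intG Gub.
have := differentiation_under_integral measurableT yI intf derf G0 intG Gub.
rewrite derive1E => D1 D0; split; first exact: D0.
by rewrite [LHS]D1; apply: eq_Rintegral => t _; rewrite d1f.
Qed.

(** The two cluster hypotheses concern the real and imaginary parts of one transform, since
    [q - i p = - i (p + i q)]. Rolle passes them on to [i t (p + i q)], which raises the moment by
    one; for [j = 0] continuity gives the values at frequency [0], the integrals of [p] and [q]. *)
Lemma zeros_cluster_moments p q j : decaying p -> decaying q ->
  zeros_cluster (re_fourier p q) -> zeros_cluster (re_fourier q (fun t => - p t)) ->
  \int[mu]_t (p t * t ^+ j) = 0 /\ \int[mu]_t (q t * t ^+ j) = 0.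
Proof.
elim: j p q => [|j IH] p q dp dq ap aq; last first.
  have dp' := decaying_id dp; have dq' := decaying_id dq.
  have [] := IH (fun t => - (q t * t)) (fun t => p t * t).
  - exact: decayingN.
  - by [].
  - by apply: (zeros_cluster_derive _ ap) => y; exact: is_derive_re_fourier.
  - have -> : (fun t => - - (q t * t)) = (fun t => q t * t) by apply/funext => t; rewrite opprK.
    apply: (zeros_cluster_derive _ aq) => y.
    have := is_derive_re_fourier y dq (decayingN dp).
    suff -> : (fun t => - (- p t * t)) = (fun t => p t * t) by [].
    by apply/funext => t; rewrite mulNr opprK.
  move=> Iq Ip; split.
    by rewrite -[RHS]Ip; apply: eq_Rintegral => t _; rewrite exprS; ring.
  apply/eqP; rewrite -oppr_eq0 -mulN1r -RintegralZl//; last exact/decaying_integrable/decayingX.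
  apply/eqP; rewrite -[RHS]Iq; apply: eq_Rintegral => t _; rewrite exprS; ring.
have z p' q' : decaying p' -> decaying q' -> zeros_cluster (re_fourier p' q') ->
    \int[mu]_t (p' t * t ^+ 0) = 0.
  move=> dp' dq' a'; have := zeros_cluster_eq0 _ a'.
  rewrite /re_fourier.
  have -> : \int[mu]_t (p' t * cos (t * 0) - q' t * sin (t * 0)) = \int[mu]_t (p' t * t ^+ 0).
    by apply: eq_Rintegral => t _; rewrite mulr0 cos0 sin0 expr0 mulr0 subr0.
  apply; apply: differentiable_continuous; apply/derivable1_diffP.
  by have := is_derive_re_fourier 0 dp' dq'; case.
by split; [exact: (z _ _ dp dq)|apply: (z _ _ dq _ aq); exact: decayingN].
Qed.

Lemma zeros_cluster_ae0 p q : decaying p -> decaying q ->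
  zeros_cluster (re_fourier p q) -> zeros_cluster (re_fourier q (fun t => - p t)) ->
  {ae mu, forall t, p t = 0} /\ {ae mu, forall t, q t = 0}.
Proof.
move=> dp dq ap aq.
by split; apply: decaying_moments_eq0 => // j; have [] := zeros_cluster_moments j dp dq ap aq.
Qed.

End Fourier.

(** * Complex-valued functions with superexponential decay *)

Section ComplexDecaying.
Context {R : realType}.
Local Notation mu := (@lebesgue_measure R).
Local Notation Re := complex.Re.
Local Notation Im := complex.Im.
Implicit Types (z w : R[i]) (a b k : R -> R[i]).

Lemma complexReM z w : Re (z * w) = Re z * Re w - Im z * Im w.
Proof. by case: z => ? ?; case: w. Qed.

Lemma complexImM z w : Im (z * w) = Re z * Im w + Im z * Re w.
Proof. by case: z => ? ?; case: w. Qed.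

Lemma complexReD z w : Re (z + w) = Re z + Re w.
Proof. by case: z => ? ?; case: w. Qed.

Lemma complexImD z w : Im (z + w) = Im z + Im w.
Proof. by case: z => ? ?; case: w. Qed.

Lemma complex_eqP z w : Re z = Re w -> Im z = Im w -> z = w.
Proof. by case: z => ? ?; case: w => ? ? /= -> ->. Qed.

(** A real-valued norm adapted to componentwise integration; it is subadditive and
    submultiplicative, as the estimates require. *)
Definition l1norm z : R := `|Re z| + `|Im z|.

Lemma l1norm_ge0 z : 0 <= l1norm z. Proof. by rewrite addr_ge0. Qed.

Lemma l1norm_eq0 z : l1norm z <= 0 -> z = 0.
Proof.
move=> z0; have /andP[r0 i0] : (Re z == 0) && (Im z == 0).
  have : (l1norm z == 0) by rewrite eq_le z0 l1norm_ge0.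
  by rewrite paddr_eq0// !normr_eq0.
by apply: complex_eqP; apply/eqP.
Qed.

Lemma l1normD z w : l1norm (z + w) <= l1norm z + l1norm w.
Proof. by rewrite /l1norm complexReD complexImD addrACA lerD// ler_normD. Qed.

Lemma l1normM z w : l1norm (z * w) <= l1norm z * l1norm w.
Proof.
have := ler_normB (Re z * Re w) (Im z * Im w).
have := ler_normD (Re z * Im w) (Im z * Re w).
by rewrite /l1norm complexReM complexImM !normrM; lra.
Qed.

Lemma l1normN z : l1norm (- z) = l1norm z.
Proof. by case: z => x y; rewrite /l1norm /= !normrN. Qed.

Definition cdecaying b := decaying (fun t => Re (b t)) /\ decaying (fun t => Im (b t)).

Definition multiplier k :=
  [/\ measurable_fun [set: R] (fun t => Re (k t)), measurable_fun [set: R] (fun t => Im (k t)),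
      exp_bounded (fun t => Re (k t)) & exp_bounded (fun t => Im (k t))].

Lemma multiplier_real (f : R -> R) : measurable_fun [set: R] f -> exp_bounded f ->
  multiplier (fun t => (f t)%:C).
Proof. by move=> mf bf; split=> //; apply: (@exp_bounded_cst _ _ 0) => t _; rewrite normr0. Qed.

Lemma multiplier_expi (y : R) : multiplier (fun t => expi (t * y)).
Proof.
split; [| |exact: exp_bounded_cos|exact: exp_bounded_sin].
- apply: (measurableT_comp (continuous_measurable_fun (@continuous_cos R))).
  exact: measurable_funM.
- apply: (measurableT_comp (continuous_measurable_fun (@continuous_sin R))).
  exact: measurable_funM.
Qed.

Lemma multiplier_cst z : multiplier (fun=> z).
Proof.
split=> //; [exact: (@exp_bounded_cst _ _ `|Re z|)|exact: (@exp_bounded_cst _ _ `|Im z|)].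
Qed.

Lemma exp_boundedD (f g : R -> R) : exp_bounded f -> exp_bounded g ->
  exp_bounded (fun t => f t + g t).
Proof.
move=> [c [C fC]] [d [D gD]]; exists (`|c| + `|d|), (`|C| + `|D|) => t t0.
apply: le_trans (ler_normD _ _) _; rewrite mulrDl.
have le_exp (x X y : R) : X * expR (x * t) <= `|X| * expR ((`|x| + `|y|) * t).
  apply: (@le_trans _ _ (`|X| * expR (x * t))).
    by apply: ler_wpM2r; [exact: expR_ge0|exact: ler_norm].
  apply: ler_wpM2l => //; rewrite ler_expR; apply: ler_wpM2r => //.
  by apply: le_trans (ler_norm x) _; rewrite lerDl.
apply: lerD; first exact: le_trans (fC _ t0) _.
by apply: le_trans (gD _ t0) _; rewrite (addrC `|c|).
Qed.

Lemma multiplierD k l : multiplier k -> multiplier l -> multiplier (fun t => k t + l t).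
Proof.
move=> [mrk mik brk bik] [mrl mil brl bil]; split.
- by under eq_fun do rewrite complexReD; exact: measurable_funD.
- by under eq_fun do rewrite complexImD; exact: measurable_funD.
- by under eq_fun do rewrite complexReD; exact: exp_boundedD.
- by under eq_fun do rewrite complexImD; exact: exp_boundedD.
Qed.

Lemma multiplierM k l : multiplier k -> multiplier l -> multiplier (fun t => k t * l t).
Proof.
move=> [mrk mik brk bik] [mrl mil brl bil]; split.
- by under eq_fun do rewrite complexReM; apply: measurable_funB; exact: measurable_funM.
- by under eq_fun do rewrite complexImM; apply: measurable_funD; exact: measurable_funM.
- under eq_fun do rewrite complexReM.
  by apply: exp_boundedD; [|apply: exp_boundedN]; exact: exp_boundedM.
- by under eq_fun do rewrite complexImM; apply: exp_boundedD; exact: exp_boundedM.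
Qed.

Lemma multiplier_sum n (F : nat -> R -> R[i]) : (forall i, multiplier (F i)) ->
  multiplier (fun t => \sum_(i < n) F i t).
Proof.
move=> mF; elim: n => [|n IH].
  by under eq_fun do rewrite big_ord0; exact: multiplier_cst.
by under eq_fun do rewrite big_ord_recr; exact: multiplierD.
Qed.

Lemma cdecayingM b k : cdecaying b -> multiplier k -> cdecaying (fun t => b t * k t).
Proof.
move=> [rb ib] [mr mi br bi]; split.
- under eq_fun do rewrite complexReM.
  by apply: decayingD; [|apply: decayingN]; exact: decayingM.
- by under eq_fun do rewrite complexImM; apply: decayingD; exact: decayingM.
Qed.

Lemma cdecayingD a b : cdecaying a -> cdecaying b -> cdecaying (fun t => a t + b t).
Proof.
move=> [ra ia] [rb ib]; split.
- by under eq_fun do rewrite complexReD; exact: decayingD.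
- by under eq_fun do rewrite complexImD; exact: decayingD.
Qed.

Lemma cdecayingJ b : cdecaying b -> cdecaying (fun t => conjc (b t)).
Proof.
move=> [rb ib]; split.
- by move: rb; congr decaying; apply/funext => t; case: (b t).
- by move: (decayingN ib); congr decaying; apply/funext => t; case: (b t).
Qed.

Lemma cintegralD a b : cdecaying a -> cdecaying b ->
  cintegral (fun t => a t + b t) = cintegral a + cintegral b.
Proof.
move=> [ra ia] [rb ib]; apply: complex_eqP; rewrite ?complexReD ?complexImD /=.
- rewrite -RintegralD//; try exact: decaying_integrable.
  by apply: eq_Rintegral => t _; rewrite complexReD.
- rewrite -RintegralD//; try exact: decaying_integrable.
  by apply: eq_Rintegral => t _; rewrite complexImD.
Qed.

Lemma cintegralZl b z : cdecaying b -> cintegral (fun t => z * b t) = z * cintegral b.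
Proof.
move=> [rb ib]; apply: complex_eqP; rewrite ?complexReM ?complexImM /=.
- rewrite -!RintegralZl//; try exact: decaying_integrable.
  rewrite -RintegralB//.
  + by apply: eq_Rintegral => t _; rewrite complexReM.
  + exact: (integrableZl measurableT (Re z) (decaying_integrable rb)).
  + exact: (integrableZl measurableT (Im z) (decaying_integrable ib)).
- rewrite -!RintegralZl//; try exact: decaying_integrable.
  rewrite -RintegralD//.
  + by apply: eq_Rintegral => t _; rewrite complexImM.
  + exact: (integrableZl measurableT (Re z) (decaying_integrable ib)).
  + exact: (integrableZl measurableT (Im z) (decaying_integrable rb)).
Qed.

Lemma cintegralJ b : cdecaying b -> cintegral (fun t => conjc (b t)) = conjc (cintegral b).
Proof.
move=> [rb ib]; apply: complex_eqP => /=.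
- by apply: eq_Rintegral => t _; case: (b t).
- rewrite -mulN1r -RintegralZl//; last exact: decaying_integrable.
  by apply: eq_Rintegral => t _; case: (b t) => x y /=; rewrite mulN1r.
Qed.

Lemma cintegral0 : cintegral (fun=> 0 : R[i]) = 0 :> R[i].
Proof. by apply: complex_eqP => /=; exact: Rintegral_cst0. Qed.

Lemma cintegral_sum n (F : nat -> R -> R[i]) : (forall i, cdecaying (F i)) ->
  cdecaying (fun t => \sum_(i < n) F i t) /\
  cintegral (fun t => \sum_(i < n) F i t) = \sum_(i < n) cintegral (F i).
Proof.
move=> dF; elim: n => [|n [IHd IH]].
  under eq_fun do rewrite big_ord0; rewrite big_ord0 cintegral0; split => //.
  have d0 : decaying (fun _ : R => 0 : R).
    split=> // c.
    by under eq_fun do rewrite mul0r; exact: integrable0.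
  by split.
under eq_fun do rewrite big_ord_recr.
by rewrite big_ord_recr/= -IH; split; [exact: cdecayingD|exact: cintegralD].
Qed.

Definition l1mass b : R := \int[mu]_t l1norm (b t).

Lemma l1mass_ge0 b : 0 <= l1mass b.
Proof. by apply: Rintegral_ge0 => t _; exact: l1norm_ge0. Qed.

Lemma decaying_l1norm b : cdecaying b -> decaying (fun t => l1norm (b t)).
Proof. by move=> [rb ib]; apply: decayingD; exact: decaying_norm. Qed.

Lemma l1norm_cintegral b : cdecaying b -> l1norm (cintegral b) <= l1mass b.
Proof.
move=> [rb ib]; rewrite /l1mass /l1norm RintegralD//;
  try by apply: decaying_integrable; exact: decaying_norm.
by apply: lerD; apply: le_normr_Rintegral => //; exact: decaying_integrable.
Qed.

Lemma l1norm_cintegralM b k (e : R) : cdecaying b -> multiplier k ->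
  (forall t : R, 0 <= t -> l1norm (k t) <= e) ->
  l1norm (cintegral (fun t => b t * k t)) <= e * l1mass b.
Proof.
move=> db mk ke; have dbk := cdecayingM db mk.
apply: le_trans (l1norm_cintegral dbk) _.
have db1 := decaying_l1norm db.
rewrite /l1mass -RintegralZl//; last exact: decaying_integrable.
apply: le_Rintegral => //.
- exact/decaying_integrable/decaying_l1norm.
- exact: (integrableZl measurableT e (decaying_integrable db1)).
move=> t _; have [t0|t0] := ltP t 0.
  have [[_ r0 _] [_ i0 _]] := db.
  by rewrite /l1norm complexReM complexImM r0// i0// !mul0r subr0 addr0 normr0 addr0 mulr0.
by apply: le_trans (l1normM _ _) _; rewrite mulrC ler_wpM2r ?l1norm_ge0// ke.
Qed.

(* Iterated form of the bound for [int int a(t) b(s) (sum_i c_i E_i (t+s)) dt ds]: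
   multiplicativity of the [E_i] makes both integrands explicit, so Fubini's
   theorem is not needed. *)
Lemma l1norm_bilinear_sum a b n (E : nat -> R -> R[i]) (c : nat -> R[i]) (e : R) :
  cdecaying a -> cdecaying b -> (forall i, multiplier (E i)) ->
  (forall i (t s : R), E i (t + s) = E i t * E i s) ->
  (forall t : R, 0 <= t -> l1norm (\sum_(i < n) c i * E i t) <= e) ->
  l1norm (\sum_(i < n) c i *
    (cintegral (fun t => a t * E i t) * cintegral (fun t => b t * E i t)))
    <= e * l1mass a * l1mass b.
Proof.
move=> da db mE EM ce.
pose A i := cintegral (fun t => a t * E i t).
(* The inner integral over [t] of the bilinear form, which multiplicativity of [E] turns into a
   finite sum in [s]. *)
pose k s := \sum_(i < n) (c i * A i) * E i s.
have mk : multiplier k.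
  apply: (@multiplier_sum n (fun i s => c i * A i * E i s)) => i.
  by apply: multiplierM => //; exact: multiplier_cst.
have kb (s : R) : 0 <= s -> l1norm (k s) <= e * l1mass a.
  move=> s0.
  have dF i : cdecaying (fun t => a t * (c i * E i (t + s))).
    apply: cdecayingM => //; apply: multiplierM; first exact: multiplier_cst.
    under eq_fun do rewrite EM; apply: multiplierM => //; exact: multiplier_cst.
  have -> : k s = cintegral (fun t => a t * \sum_(i < n) c i * E i (t + s)).
    under eq_fun do rewrite mulr_sumr.
    have [_ ->] := cintegral_sum n dF.
    apply: eq_bigr => i _; rewrite /A.
    have daE : cdecaying (fun t => a t * E i t) by exact: cdecayingM.
    rewrite mulrAC -cintegralZl//; congr cintegral; apply/funext => t.
    by rewrite EM; ring.
  apply: (@l1norm_cintegralM a (fun t => \sum_(i < n) c i * E i (t + s))) => //.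
    apply: (@multiplier_sum n (fun i t => c i * E i (t + s))) => i.
    apply: multiplierM; first exact: multiplier_cst.
    under eq_fun do rewrite EM; apply: multiplierM => //; exact: multiplier_cst.
  by move=> t t0; apply: ce; rewrite addr_ge0.
have -> : \sum_(i < n) c i * (A i * cintegral (fun t => b t * E i t)) =
    cintegral (fun s => b s * k s).
  have dF i : cdecaying (fun s => b s * ((c i * A i) * E i s)).
    by apply: cdecayingM => //; apply: multiplierM => //; exact: multiplier_cst.
  have -> : (fun s => b s * k s) = (fun s => \sum_(i < n) b s * (c i * A i * E i s)).
    by apply/funext => s; rewrite /k mulr_sumr.
  have [_ ->] := cintegral_sum n dF.
  apply: eq_bigr => i _; have dbE : cdecaying (fun t => b t * E i t) by exact: cdecayingM.
  by rewrite mulrA -cintegralZl//; congr cintegral; apply/funext => t; ring.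
exact: l1norm_cintegralM.
Qed.

End ComplexDecaying.

(** * From Laplace moduli to a Fourier product identity *)

Section LaplaceModuli.
Context {R : realType}.
Local Notation mu := (@lebesgue_measure R).
Local Notation Re := complex.Re.
Local Notation Im := complex.Im.
Implicit Types (z w : R[i]) (a b : R -> R[i]).

Lemma conjcM z w : conjc (z * w) = conjc z * conjc w.
Proof. exact: rmorphM. Qed.

Lemma expiD (x y : R) : expi (x + y) = expi x * expi y.
Proof. by apply: complex_eqP; rewrite ?complexReM ?complexImM /= ?cosD ?sinD; ring. Qed.

Lemma expiN (x : R) : expi (- x) = conjc (expi x).
Proof. by apply: complex_eqP; rewrite /= ?cosN ?sinN. Qed.

(** With [phi] the cosine or the sine these are the components of the damped kernel in the variable
    [W]. On []0, 1]] the derivative is [2 x phi + c x phi']: the factor [x ^ 2] absorbs the [1 / x]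
    coming from [ln]. *)
Lemma sqr_phase_ln_lipschitz (phi phi' : R -> R) (c : R) :
  (forall x : R, is_derive x 1 phi (phi' x)) ->
  (forall x, `|phi x| <= 1) -> (forall x, `|phi' x| <= 1) ->
  forall x y : R, 0 <= x <= 1 -> 0 <= y <= 1 ->
  `|x ^+ 2 * phi (c * ln x) - y ^+ 2 * phi (c * ln y)| <= (2 + `|c|) * `|x - y|.
Proof.
move=> dphi phi1 phi'1.
pose g x := x ^+ 2 * phi (c * ln x).
suff H x y : 0 <= x -> y <= 1 -> x < y -> `|g y - g x| <= (2 + `|c|) * `|y - x|.
  move=> x y /andP[x0 x1] /andP[y0 y1]; have [xy|yx|->] := ltgtP x y.
  - by rewrite distrC (distrC x); exact: H.
  - exact: H.
  - by rewrite !subrr normr0 mulr0.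
move=> x0 y1 xy; have y0 : 0 < y by exact: le_lt_trans xy.
(* The endpoint [0] is compared directly: the square removes the conventional value of [ln] there,
   and [y ^ 2 <= y] bounds the rest. *)
have [x0'|xpos] := leP x 0.
  have -> : x = 0 by apply/eqP; rewrite eq_le x0'.
  rewrite /g expr0n /= mul0r !subr0 normrM normrX.
  have c0 := normr_ge0 c; have := phi1 (c * ln y); rewrite (gtr0_norm y0) => p1.
  have pp := normr_ge0 (phi (c * ln y)); nra.
have dg (t : R) : 0 < t -> is_derive t 1 g (2 * t * phi (c * ln t) + t * c * phi' (c * ln t)).
  move=> t0; have dln := is_derive1_ln t0.
  have d1 : is_derive t 1 (fun t : R => c * ln t) (c * t^-1) by apply: is_derive_eq.
  have d2 := @is_derive1_comp R phi (fun t : R => c * ln t) t _ _ (dphi (c * ln t)) d1.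
  have d3 := is_deriveM (is_deriveX 2 (is_derive_id t 1)) d2.
  have -> : g = (id ^+ 2 : R -> R) * (phi \o (fun t : R => c * ln t)).
    by apply/funext => s; rewrite /g fctE /= fctE.
  apply: (is_derive_eq d3).
  have -> : (id ^+ 2 : R -> R) t = t ^+ 2 by rewrite fctE.
  by rewrite /GRing.scale /= expr1; field; rewrite gt_eqF.
have cont : {within `[x, y], continuous g}.
  apply: derivable_within_continuous => t; rewrite in_itv /= => /andP[xt _].
  by have := dg t (lt_le_trans xpos xt); case.
have dgi t : t \in `]x, y[ ->
    is_derive t 1 g (2 * t * phi (c * ln t) + t * c * phi' (c * ln t)).
  by rewrite in_itv /= => /andP[xt _]; apply: dg; exact: lt_trans xt.
have [t] := MVT xy dgi cont.
rewrite in_itv /= => /andP[xt ty] ->; rewrite normrM ler_wpM2r//.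
have t0 : 0 < t by exact: lt_trans xt.
have t1 : t <= 1 by exact: le_trans (ltW ty) y1.
have b1 : t * `|phi (c * ln t)| <= 1.
  by rewrite -[1]mulr1 ler_pM ?(ltW t0).
have b2 : t * `|phi' (c * ln t)| <= 1.
  by rewrite -[1]mulr1 ler_pM ?(ltW t0).
apply: le_trans (ler_normD _ _) _; rewrite !normrM (gtr0_norm t0) (ger0_norm (ler0n _ 2)).
apply: lerD; first lra.
by rewrite mulrAC ler_piMl.
Qed.

(** In the variable [W = expR (- k t)] the target is [W ^ 2] times the cosine and sine of
    [- (y / k) ln W = t y]. Approximants [P] and [Q] of the two components combine into complex
    coefficients, and [W ^ i] is the exponential of rate [i k]. *)
Lemma phase_exp_approx (k y e : R) : 0 < k -> 0 < e ->
  exists n (c : nat -> R[i]), forall t : R, 0 <= t ->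
    l1norm (\sum_(i < n) c i * (expR (- (i%:R * k) * t))%:C
            - (expR (- (2 * k) * t))%:C * expi (t * y)) <= e.
Proof.
move=> k0 e0; have e2 : 0 < e / 2 by rewrite divr_gt0.
have [P HP] := lipschitz_poly_approx (sqr_phase_ln_lipschitz (- y / k) (@is_derive_cos R)
  (fun x => ltac:(by rewrite ler_norml cos_geN1 cos_le1))
  (fun x => ltac:(by rewrite normrN ler_norml sin_geN1 sin_le1))) e2.
have [Q HQ] := lipschitz_poly_approx (sqr_phase_ln_lipschitz (- y / k) (@is_derive_sin R)
  (fun x => ltac:(by rewrite ler_norml sin_geN1 sin_le1))
  (fun x => ltac:(by rewrite ler_norml cos_geN1 cos_le1))) e2.
pose n := maxn (size P) (size Q).
exists n, (fun i => P`_i +i* Q`_i) => t t0.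
pose W := expR (- (k * t)).
have W01 : 0 <= W <= 1 by apply: expRN_itv; rewrite mulr_ge0// ltW.
have WX i : expR (- (i%:R * k) * t) = W ^+ i.
  by rewrite /W -expRM_natl; congr expR; ring.
have lnW : - y / k * ln W = t * y by rewrite /W expRK; field; rewrite gt_eqF.
rewrite (WX 2%N) /l1norm complexReD complexImD.
have -> : Re (- ((W ^+ 2)%:C * expi (t * y))) = - (W ^+ 2 * cos (t * y)) by rewrite /= mul0r subr0.
have -> : Im (- ((W ^+ 2)%:C * expi (t * y))) = - (W ^+ 2 * sin (t * y)) by rewrite /= mul0r addr0.
have -> : Re (\sum_(i < n) (P`_i +i* Q`_i) * (expR (- (i%:R * k) * t))%:C) = P.[W].
  rewrite (horner_coef_wide _ (leq_maxl _ _ : (size P <= n)%N)).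
  rewrite (big_morph (@complex.Re R) complexReD erefl); apply: eq_bigr => i _.
  by rewrite complexReM /= WX mulr0 subr0.
have -> : Im (\sum_(i < n) (P`_i +i* Q`_i) * (expR (- (i%:R * k) * t))%:C) = Q.[W].
  rewrite (horner_coef_wide _ (leq_maxr _ _ : (size Q <= n)%N)).
  rewrite (big_morph (@complex.Im R) complexImD erefl); apply: eq_bigr => i _.
  by rewrite complexImM /= WX mulr0 add0r.
have := HP W W01; have := HQ W W01; rewrite lnW !(distrC _ _.[W]); lra.
Qed.

(** Positive sign and no [2 pi] in the exponent; a Gabor frequency [w] therefore appears as
    [- (2 pi w)]. *)
Definition fourier b (y : R) : R[i] := cintegral (fun t => b t * expi (t * y)).

Definition damp (k : R) b : R -> R[i] := fun t => b t * (expR (- k * t))%:C.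

Lemma multiplier_exp (k : R) : multiplier (fun t : R => (expR (k * t))%:C).
Proof. by apply: multiplier_real; [exact: measurable_expM|exact: exp_bounded_exp]. Qed.

Lemma cdecaying_damp k b : cdecaying b -> cdecaying (damp k b).
Proof. by move=> db; apply: cdecayingM => //; exact: multiplier_exp. Qed.

Lemma fourierJ b (y : R) : cdecaying b ->
  fourier (fun t => conjc (b t)) y = conjc (fourier b (- y)).
Proof.
move=> db; rewrite /fourier -cintegralJ; last by apply: cdecayingM => //; exact: multiplier_expi.
by congr cintegral; apply/funext => t; rewrite conjcM mulrN expiN conjcK.
Qed.

(* The squared moduli of the Laplace transform at [i k] are the moments of
   [a(t) conj(a(s))] in [expR (- k (t + s))]; by density they determine all
   integrals of [a(t) conj(a(s)) G(t + s)], in particular for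
   [G t = expR (- 2 k t) expi (t y)]. *)
Lemma laplace_moduli_fourier a b (k : R) : 0 < k -> cdecaying a -> cdecaying b ->
  (forall i : nat, `|cintegral (damp (i%:R * k) a)| = `|cintegral (damp (i%:R * k) b)|) ->
  forall y : R,
    fourier (damp (2 * k) a) y * conjc (fourier (damp (2 * k) a) (- y)) =
    fourier (damp (2 * k) b) y * conjc (fourier (damp (2 * k) b) (- y)).
Proof.
move=> k0 da db lab y.
pose prod a := fourier (damp (2 * k) a) y * conjc (fourier (damp (2 * k) a) (- y)).
pose M := l1mass a * l1mass (fun t => conjc (a t)) + l1mass b * l1mass (fun t => conjc (b t)).
have M0 : 0 <= M by rewrite addr_ge0// mulr_ge0// l1mass_ge0.
apply/eqP; rewrite -subr_eq0; apply/eqP/l1norm_eq0.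
apply/ler_addgt0Pr => e e0; rewrite add0r.
have [n [c approx]] := phase_exp_approx y k0 (divr_gt0 e0 (ltr_wpDl M0 ltr01)).
(* The target kernel is appended at index [n] with coefficient [-1], so the sum of [n.+1] terms is
   the approximation error. Both kinds of kernel turn sums into products, as the bilinear bound
   demands. *)
pose E i (t : R) : R[i] := if (i < n)%N then (expR (- (i%:R * k) * t))%:C
                   else (expR (- (2 * k) * t))%:C * expi (t * y).
pose d i : R[i] := if (i < n)%N then c i else -1.
have mE i : multiplier (E i).
  rewrite /E; case: (i < n)%N; first exact: multiplier_exp.
  by apply: multiplierM; [exact: multiplier_exp|exact: multiplier_expi].
have EM i (t s : R) : E i (t + s) = E i t * E i s.
  rewrite /E; case: ifP => _; rewrite mulrDr expRD rmorphM//=.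
  by rewrite (mulrDl t s y) expiD; ring.
have Eb (t : R) : 0 <= t -> l1norm (\sum_(i < n.+1) d i * E i t) <= e / (M + 1).
  move=> /approx; rewrite big_ord_recr /= /d /E ltnn mulN1r; congr (l1norm (_ - _) <= _).
  by apply: eq_bigr => i _; rewrite ltn_ord.
have sumE x : cdecaying x ->
    \sum_(i < n.+1) d i *
      (cintegral (fun t => x t * E i t) * cintegral (fun t => conjc (x t) * E i t))
    = \sum_(i < n) c i * `|cintegral (damp (i%:R * k) x)| ^+ 2 - prod x.
  move=> dx; rewrite big_ord_recr /=; congr (_ + _).
    apply: eq_bigr => i _; rewrite /d /E ltn_ord; congr (_ * _).
    rewrite sqr_normc -cintegralJ; last exact: cdecaying_damp.
    congr (_ * cintegral _); apply/funext => t.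
    by rewrite /damp conjcM conjc_real.
  rewrite /d /E ltnn mulN1r; congr (- (_ * _)).
    by congr cintegral; apply/funext => t; rewrite /damp mulrA.
  rewrite -fourierJ; last exact: cdecaying_damp.
  congr cintegral; apply/funext => t.
  by rewrite /damp conjcM conjc_real mulrA.
have bound x : cdecaying x -> l1norm (\sum_(i < n.+1)
    d i * (cintegral (fun t => x t * E i t) * cintegral (fun t => conjc (x t) * E i t)))
    <= e / (M + 1) * l1mass x * l1mass (fun t => conjc (x t)).
  by move=> dx; apply: l1norm_bilinear_sum => //; exact: cdecayingJ.
have := bound _ da; have := bound _ db; rewrite !sumE//.
(* The equality of moduli enters here: the approximating sums for [a] and [b] coincide. *)
have -> : \sum_(i < n) c i * `|cintegral (damp (i%:R * k) a)| ^+ 2 =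
    \sum_(i < n) c i * `|cintegral (damp (i%:R * k) b)| ^+ 2.
  by apply: eq_bigr => i _; rewrite lab.
set S := \sum_(i < n) _ => hb ha.
have -> : fourier (damp (2 * k) a) y * conjc (fourier (damp (2 * k) a) (- y)) -
    fourier (damp (2 * k) b) y * conjc (fourier (damp (2 * k) b) (- y)) =
    (S - prod b) + - (S - prod a) by rewrite /prod; ring.
apply: le_trans (l1normD _ _) _; rewrite l1normN.
apply: (@le_trans _ _ (e / (M + 1) * M)).
  by apply: le_trans (lerD hb ha) _; rewrite /M; lra.
rewrite -mulrA ler_piMr ?(ltW e0)// mulrC ler_pdivrMr ?ltr_wpDl//.
by rewrite mul1r lerDl.
Qed.

End LaplaceModuli.

(** * The Gabor transform as a damped Fourier transform *)

Section GaborLaplace.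
Context {R : realType}.
Local Notation mu := (@lebesgue_measure R).
Local Notation Re := complex.Re.
Local Notation Im := complex.Im.
Implicit Types (z w : R[i]) (f : R -> R[i]).

Lemma sqr_Re_norm z : Re `|z| ^+ 2 = Re z ^+ 2 + Im z ^+ 2.
Proof. by rewrite normc_def /= sqr_sqrtr// addr_ge0 ?sqr_ge0. Qed.

Lemma L2_integrable_sqr f : L2 f ->
  mu.-integrable [set: R] (EFin \o (fun t => Re `|f t| ^+ 2)).
Proof.
move=> [[mr mi] ff]; apply: Lfun2_integrable_sqr; rewrite inE; apply/andP; split.
- rewrite inE /=.
  have -> : (fun t => Re `|f t|) = (fun t => Num.sqrt (Re (f t) ^+ 2 + Im (f t) ^+ 2)).
    by apply/funext => t; rewrite normc_def.
  apply: (measurableT_comp (continuous_measurable_fun (@sqrt_continuous R))).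
  by apply: measurable_funD; exact: measurable_funX.
- by rewrite inE.
Qed.

(** [2 c t <= c ^ 2 + t ^ 2], and [pi >= 2] leaves at least [t ^ 2] of Gaussian decay in the
    exponent. *)
Lemma gauss_exp_sqr_le (c t : R) : (gauss t * expR (c * t)) ^+ 2 <= expR (c ^+ 2) * gauss_fun t.
Proof.
rewrite /gauss /gauss_fun -expRD -expRM_natl -expRD ler_expR.
have := pi_ge2 R; have := sqr_ge0 t; have := sqr_ge0 (c - t); nra.
Qed.

Lemma measurable_gauss : measurable_fun [set: R] (gauss : R -> R).
Proof.
apply: measurableT_comp => //; apply: measurable_funN.
by apply: measurable_funM => //; exact: measurable_funX.
Qed.

(** With [g t = gauss t * expR (c * t)], the bound [|q| g <= q ^ 2 + g ^ 2] gives an integrable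
    majorant for every [c]. *)
Lemma decaying_gauss (q : R -> R) : measurable_fun [set: R] q ->
  mu.-integrable [set: R] (EFin \o (fun t => q t ^+ 2)) ->
  decaying (fun t => if 0 <= t then q t * gauss t else 0).
Proof.
move=> mq iq.
have mg := measurable_gauss.
have mqg : measurable_fun [set: R] (fun t => if 0 <= t then q t * gauss t else 0).
  apply: measurable_fun_ifT => //; last exact: measurable_funM.
  exact: measurable_fun_ler.
split=> // [t t0|c]; first by rewrite leNgt t0.
apply: (@le_integrable _ _ R mu [set: R] measurableT _
  (EFin \o (fun t => q t ^+ 2 + expR (c ^+ 2) * gauss_fun t))).
- by apply/measurable_EFinP; apply: measurable_funM => //; exact: measurable_expM.
- move=> t _; rewrite lee_fin.
  have g0 : 0 <= expR (c ^+ 2) * gauss_fun t by rewrite mulr_ge0 ?expR_ge0 ?gauss_fun_ge0.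
  rewrite [leRHS]ger0_norm ?addr_ge0 ?sqr_ge0//.
  case: ifP => _; last by rewrite mul0r normr0 addr_ge0 ?sqr_ge0.
  have := gauss_exp_sqr_le c t; rewrite -mulrA normrM.
  have : 0 <= gauss t * expR (c * t) by rewrite mulr_ge0 ?expR_ge0.
  move: (gauss t * _) => g gpos gle; rewrite (ger0_norm gpos).
  have := sqr_ge0 (`|q t| - g); have := real_normK (num_real (q t)); nra.
- have ig := integrableZl measurableT (expR (c ^+ 2)) (@integrableT_gauss R).
  have := integrableD measurableT iq ig.
  by apply: eq_integrable => // t _; rewrite /= EFinD EFinM.
Qed.

(** The [b] of the overview. The test on [t] replaces almost everywhere support in the half-line by
    the pointwise vanishing that [decaying] asks for. *)
Definition gauss_half f : R -> R[i] := fun t => if 0 <= t then f t * (gauss t)%:C else 0.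

Lemma cdecaying_gauss_half f : L2 f -> cdecaying (gauss_half f).
Proof.
move=> Lf; have [[mr mi] _] := Lf; have isq := L2_integrable_sqr Lf.
have sq (q : R -> R) : measurable_fun [set: R] q ->
    (forall t, q t ^+ 2 <= Re `|f t| ^+ 2) ->
    mu.-integrable [set: R] (EFin \o (fun t => q t ^+ 2)).
  move=> mq qle; apply: (@le_integrable _ _ R mu [set: R] measurableT _ _ _ _ isq).
    by apply/measurable_EFinP; exact: measurable_funX.
  move=> t _; rewrite lee_fin [leLHS]ger0_norm ?sqr_ge0// [leRHS]ger0_norm ?sqr_ge0//.
split.
- have := decaying_gauss mr (sq _ mr (fun t => ltac:(by rewrite sqr_Re_norm lerDl sqr_ge0))).
  congr decaying; apply/funext => t; rewrite /gauss_half; case: ifP => // _.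
  by rewrite complexReM /= mulr0 subr0.
- have := decaying_gauss mi (sq _ mi (fun t => ltac:(by rewrite sqr_Re_norm lerDr sqr_ge0))).
  congr decaying; apply/funext => t; rewrite /gauss_half; case: ifP => // _.
  by rewrite complexImM /= mulr0 add0r.
Qed.

Lemma eq_cintegral_ae f g : cmeasurable f -> cmeasurable g ->
  {ae mu, forall t, f t = g t} -> cintegral f = cintegral g.
Proof.
move=> [fr fi] [gr gi] fg; apply: complex_eqP; congr fine; apply: ae_eq_integral => //;
  try exact/measurable_EFinP.
- by apply: filterS fg; first exact: (ae_filter_ringOfSetsType mu); move=> t -> _.
- by apply: filterS fg; first exact: (ae_filter_ringOfSetsType mu); move=> t -> _.
Qed.

Lemma cmeasurableM f (k : R -> R[i]) : cmeasurable f -> multiplier k ->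
  cmeasurable (fun t => f t * k t).
Proof.
move=> [mr mi] [kr ki _ _]; split.
- by under eq_fun do rewrite complexReM; apply: measurable_funB; exact: measurable_funM.
- by under eq_fun do rewrite complexImM; apply: measurable_funD; exact: measurable_funM.
Qed.

(* [gauss (t - x) = gauss x * gauss t * expR (2 pi x t)], so the modulus at
   abscissa [- i alpha] is a Laplace integral with exponent [2 pi alpha i]. *)
Lemma gabor_laplace f (alpha w : R) (i : nat) : L2_Rplus f ->
  gabor f (- (alpha * i%:R), w) = (gauss (alpha * i%:R))%:C *
    cintegral (damp (i%:R * (2 * pi * alpha))
      (fun t => gauss_half f t * expi (t * - (2 * pi * w)))).
Proof.
move=> [Lf f0]; have dg := cdecaying_gauss_half Lf; have [mf _] := Lf.
have me := @multiplier_expi R (- (2 * pi * w)).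
have mx := @multiplier_exp R (- (i%:R * (2 * pi * alpha))).
rewrite -cintegralZl; last by apply: cdecaying_damp; exact: cdecayingM.
have mg : measurable_fun [set: R] (fun t : R => gauss (t - - (alpha * i%:R))).
  by apply: (measurableT_comp measurable_gauss); exact: measurable_funB.
apply: eq_cintegral_ae.
- have -> : (fun t => f t * (gauss (t - (- (alpha * i%:R), w).1))%:C *
      expi (- (2 * pi * (- (alpha * i%:R), w).2 * t))) =
     (fun t => f t * ((gauss (t - - (alpha * i%:R)))%:C * expi (t * - (2 * pi * w)))).
    by apply/funext => t /=; rewrite mulrA; congr (_ * expi _); ring.
  apply: cmeasurableM => //; apply: multiplierM => //; apply: multiplier_real => //.
  apply: (@exp_bounded_cst _ _ 1) => t _; rewrite ger0_norm ?expR_ge0//.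
  by rewrite -expR0 ler_expR oppr_le0 mulr_ge0 ?sqr_ge0 ?pi_ge0.
- have [[rm _ _] [im _ _]] := cdecayingM (cdecayingM (cdecayingM dg me) mx)
    (multiplier_cst (gauss (alpha * i%:R))%:C).
  have -> : (fun t => (gauss (alpha * i%:R))%:C * damp (i%:R * (2 * pi * alpha))
      (fun t => gauss_half f t * expi (t * - (2 * pi * w))) t) =
     (fun t => gauss_half f t * expi (t * - (2 * pi * w)) *
        (expR (- (i%:R * (2 * pi * alpha)) * t))%:C * (gauss (alpha * i%:R))%:C).
    by apply/funext => t; rewrite mulrC.
  by split.
apply: filterS f0; first exact: (ae_filter_ringOfSetsType mu).
move=> t ft; rewrite /damp /gauss_half /=; case: ifPn => t0; last first.
  by rewrite ft ?mul0r ?mulr0//= in_itv /= andbT; exact/negP.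
have -> : gauss (t - - (alpha * i%:R)) =
    gauss (alpha * i%:R) * gauss t * expR (- (i%:R * (2 * pi * alpha)) * t).
  by rewrite /gauss -!expRD; congr expR; ring.
have -> : - (2 * pi * w * t) = t * - (2 * pi * w) by ring.
rewrite !rmorphM /=; ring.
Qed.

End GaborLaplace.

(** * Uniqueness from Fourier products *)

Section FourierUniqueness.
Context {R : realType}.
Local Notation mu := (@lebesgue_measure R).
Local Notation Re := complex.Re.
Local Notation Im := complex.Im.
Implicit Types (z w : R[i]) (b : R -> R[i]).

Lemma Re_fourier b (y : R) :
  Re (fourier b y) = re_fourier (fun t => Re (b t)) (fun t => Im (b t)) y.
Proof. by apply: eq_Rintegral => t _; rewrite complexReM. Qed.

Lemma Im_fourier b (y : R) :
  Im (fourier b y) = re_fourier (fun t => Im (b t)) (fun t => - Re (b t)) y.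
Proof. by apply: eq_Rintegral => t _; rewrite complexImM /=; ring. Qed.

Lemma fourier_shift b (x y : R) :
  fourier (fun t => b t * expi (t * x)) y = fourier b (x + y).
Proof. by congr cintegral; apply/funext => t; rewrite mulrDr expiD mulrA. Qed.

Lemma fourier_ae0 b : cdecaying b -> {ae mu, forall t, b t = 0} ->
  forall y, fourier b y = 0.
Proof.
move=> db b0 y; rewrite -[RHS](@cintegral0 R).
have [[mr _ _] [mi _ _]] := cdecayingM db (multiplier_expi y).
apply: eq_cintegral_ae => //.
by apply: filterS b0; first exact: (ae_filter_ringOfSetsType mu); move=> t ->; rewrite mul0r.
Qed.

(** Modulation by [expi (t * x)] moves the cluster point [x] to [0]; the factor is invertible, so
    nullity carries back to [b]. *)
Lemma fourier_zeros_ae0 b (x : R) : cdecaying b ->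
  (forall e : R, 0 < e -> exists d : R, 0 < `|d| < e /\ fourier b (x + d) = 0) ->
  {ae mu, forall t, b t = 0}.
Proof.
move=> db acc; pose a t := b t * expi (t * x).
have [dr di] : cdecaying a by apply: cdecayingM => //; exact: multiplier_expi.
have [||r0 i0] := zeros_cluster_ae0 dr di.
- move=> e /acc[d [de bd]]; exists d; split => //.
  by rewrite -Re_fourier /a fourier_shift bd.
- move=> e /acc[d [de bd]]; exists d; split => //.
  by rewrite -Im_fourier /a fourier_shift bd.
apply: filterS2 r0 i0; first exact: (ae_filter_ringOfSetsType mu).
move=> t r0 i0; have at0 : a t = 0 by exact: complex_eqP.
rewrite -[LHS]mulr1.
have -> : 1 = expi (t * x) * expi (- (t * x)) by rewrite -expiD subrr /expi cos0 sin0.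
by rewrite mulrA -/(a t) at0 mul0r.
Qed.

(** A transform vanishing on a whole ball would have zeros clustering at its centre. *)
Lemma fourier_nonzero_near b (x r : R) : cdecaying b -> ~ {ae mu, forall t, b t = 0} ->
  0 < r -> exists2 y : R, `|x - y| < r & fourier b y != 0.
Proof.
move=> db nb r0; apply: contrapT => H; apply: nb; apply: (fourier_zeros_ae0 db (x := x)).
move=> e e0; exists (Num.min e r / 2).
have m0 : 0 < Num.min e r by rewrite lt_min e0.
have m2 : Num.min e r / 2 < Num.min e r by rewrite gtr_pMr// invf_lt1// ltr1n.
rewrite gtr0_norm ?divr_gt0//; split.
  by rewrite /= (lt_le_trans m2)// ge_min lexx.
apply/eqP; apply: contrapT => /negP nz; apply: H; exists (x + Num.min e r / 2) => //.
rewrite opprD addrA subrr add0r normrN gtr0_norm ?divr_gt0//.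
by rewrite (lt_le_trans m2)// ge_min lexx orbT.
Qed.

Lemma continuous_re_fourier (p q : R -> R) : decaying p -> decaying q ->
  continuous (re_fourier p q).
Proof.
move=> dp dq y; apply: differentiable_continuous; apply/derivable1_diffP.
by have := is_derive_re_fourier y dp dq; case.
Qed.

Lemma open_fourier_nonzero b (s c : R) : cdecaying b ->
  open [set u : R | fourier b (s * u + c) != 0].
Proof.
move=> [dr di].
have aff : continuous (fun u : R => s * u + c).
  by move=> u; apply: cvgD; [exact: mulrl_continuous|exact: cvg_cst].
have op (phi : R -> R) : continuous phi -> open [set u : R | phi (s * u + c) != 0].
  move=> cphi; apply: (@open_comp _ _ (phi \o (fun u => s * u + c)) [set x | x != 0]).
    by move=> u _; apply: continuous_comp; [exact: aff|exact: cphi].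
  exact: open_neq.
have -> : [set u : R | fourier b (s * u + c) != 0] =
    [set u | re_fourier (fun t => Re (b t)) (fun t => Im (b t)) (s * u + c) != 0] `|`
    [set u | re_fourier (fun t => Im (b t)) (fun t => - Re (b t)) (s * u + c) != 0].
  apply/seteqP; split => u /=; rewrite -Re_fourier -Im_fourier.
    move=> nz; have [r0|r0] := eqVneq (Re (fourier b (s * u + c))) 0; last by left.
    by right; apply: contra nz => /eqP i0; apply/eqP; exact: complex_eqP.
  by move=> [nz|nz]; apply: contra nz => /eqP ->.
by apply: openU; apply: op; apply: continuous_re_fourier => //; exact: decayingN.
Qed.

Lemma dense_fourier_nonzero b (s c : R) : cdecaying b -> ~ {ae mu, forall t, b t = 0} ->
  s != 0 -> dense [set u : R | fourier b (s * u + c) != 0].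
Proof.
move=> db nb s0 O [x Ox] oO.
have [r /= r0 rO] : nbhs x O by apply: open_nbhs_nbhs.
have sr0 : 0 < `|s| * r by rewrite mulr_gt0 ?normr_gt0.
have [y xy ny] := fourier_nonzero_near (s * x + c) db nb sr0.
exists ((y - c) / s); split.
  apply: rO => /=; have -> : x - (y - c) / s = (s * x + c - y) / s by field.
  by rewrite normrM normfV ltr_pdivrMr ?normr_gt0// (mulrC r).
by rewrite /= mulrCA mulfV// mulr1 subrK.
Qed.

(** Baire category: each condition holds on a dense open set. The affine arguments cover both [u]
    and the reflected points [- u - v n]. *)
Lemma common_fourier_nonzero (b : nat -> R -> R[i]) (s c : nat -> R) :
  (forall n, cdecaying (b n)) -> (forall n, ~ {ae mu, forall t, b n t = 0}) ->
  (forall n, s n != 0) ->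
  exists u : R, forall n, fourier (b n) (s n * u + c n) != 0.
Proof.
move=> db nb s0.
pose D n : set R^o := [set u : R | fourier (b n) (s n * u + c n) != 0].
have [|//||u [_ Du]] := @Baire R R^o D _ setT.
- move=> n; split; first exact: open_fourier_nonzero.
  exact: dense_fourier_nonzero.
- by exists 0.
- exact: openT.
by exists u => n; exact: Du.
Qed.

(** Settles the degenerate case in which no quotient can be formed. If [b2] were not null, both of
    its factors would be nonzero at some common [u], while their product is zero. *)
Lemma fourier_product_ae0 b1 b2 (v : R) : cdecaying b1 -> cdecaying b2 ->
  (forall u : R, fourier b1 u * conjc (fourier b1 (- u - v)) =
                 fourier b2 u * conjc (fourier b2 (- u - v))) ->
  {ae mu, forall t, b1 t = 0} -> {ae mu, forall t, b2 t = 0}.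
Proof.
move=> d1 d2 prod b10; apply: contrapT => nb2.
pose s n : R := if n is 0%N then 1 else -1.
pose c n : R := if n is 0%N then 0 else - v.
have [] := @common_fourier_nonzero (fun=> b2) s c => //.
  by case=> [|n]; rewrite /s ?oppr_eq0 oner_eq0.
move=> u nz; have := prod u; rewrite !(fourier_ae0 d1 b10) mul0r => /esym/eqP.
have := nz 0%N; have := nz 1%N; rewrite /s /c mulN1r mul1r addr0 => n1 n0.
by rewrite mulf_eq0 conjc_eq0 (negbTE n0) (negbTE n1).
Qed.

(* The factor [rho] is the quotient of the two transforms at a point [u] where
   nothing vanishes. Applying the product identity at [v_(n+1)] and then at
   [v_n] carries it to [u + v_(n+1) - v_n], and these points accumulate. *)
Lemma fourier_product_phase b1 b2 (v : nat -> R) (l : R) : cdecaying b1 -> cdecaying b2 ->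
  (forall (n : nat) (u : R), fourier b1 u * conjc (fourier b1 (- u - v n)) =
                 fourier b2 u * conjc (fourier b2 (- u - v n))) ->
  (forall e : R, 0 < e -> exists n, 0 < `|v n.+1 - v n - l| < e) ->
  exists2 rho : R[i], `|rho| = 1 & {ae mu, forall t, b1 t = rho * b2 t}.
Proof.
move=> d1 d2 prod acc.
have [b10|nb1] := pselect {ae mu, forall t, b1 t = 0}.
  exists 1; first exact: normr1.
  have b20 := fourier_product_ae0 d1 d2 (prod 0%N) b10.
  apply: filterS2 b10 b20; first exact: (ae_filter_ringOfSetsType mu).
  by move=> t -> ->; rewrite mulr0.
have nb2 : ~ {ae mu, forall t, b2 t = 0}.
  move=> b20; apply: nb1.
  by apply: (fourier_product_ae0 (v := v 0%N) d2 d1 _ b20) => u; rewrite prod.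
(* Index [0] stands for the first transform at [u], index [1] for the second at [u], and index
   [n.+2] for the first at [- u - v n]. *)
pose b n := if n is 1%N then b2 else b1.
pose s n : R := if n is n.+2 then -1 else 1.
pose c n : R := if n is n.+2 then - v n else 0.
have [] := @common_fourier_nonzero b s c.
- by case=> [|[|n]].
- by case=> [|[|n]].
- by case=> [|[|n]]; rewrite /s ?oppr_eq0 oner_eq0.
move=> u nz.
have n1 : fourier b1 u != 0 by have := nz 0%N; rewrite /s /c mul1r addr0.
have n2 : fourier b2 u != 0 by have := nz 1%N; rewrite /s /c mul1r addr0.
have nv n : fourier b1 (- u - v n) != 0 by have := nz n.+2; rewrite /s /c mulN1r.
have nv2 n : fourier b2 (- u - v n) != 0.
  have := prod n u; apply: contra_eq_neq => ->; rewrite conjc0 mulr0.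
  by rewrite mulf_neq0// conjc_eq0.
pose rho := fourier b1 u / fourier b2 u.
have rho0 : rho != 0 by rewrite mulf_neq0// invr_eq0.
have F1v n : conjc (fourier b1 (- u - v n)) = rho^-1 * conjc (fourier b2 (- u - v n)).
  apply: (mulfI n1); rewrite prod /rho invf_div; field.
  by rewrite n1.
clearbody rho.
(* At the point [- u - v n.+1] the identity for [v n] has its second factors at
   [u + (v n.+1 - v n)]; the first factors have a known ratio by [F1v] and cancel. *)
have shift n : fourier b1 (u + (v n.+1 - v n)) = rho * fourier b2 (u + (v n.+1 - v n)).
  have := prod n (- u - v n.+1).
  have -> : - (- u - v n.+1) - v n = u + (v n.+1 - v n) by ring.
  move/(congr1 conjc); rewrite !conjcM !conjcK F1v -!mulrA => H.
  have nc : conjc (fourier b2 (- u - v n.+1)) != 0 by rewrite conjc_eq0.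
  apply: (mulfI (mulf_neq0 (invr_neq0 rho0) nc)); rewrite -!mulrA H.
  by rewrite (mulrCA _ rho) mulKf.
(* The transform of this difference vanishes at the shifted points, which cluster at [u + l]. *)
have dd : cdecaying (fun t => b1 t + b2 t * - rho).
  by apply: cdecayingD => //; apply: cdecayingM => //; exact: multiplier_cst.
have fE y : fourier (fun t => b1 t + b2 t * - rho) y = fourier b1 y - rho * fourier b2 y.
  have me := multiplier_expi y.
  have d1e := cdecayingM d1 me; have d2e := cdecayingM d2 me.
  rewrite /fourier -mulNr -cintegralZl// -cintegralD//.
    by congr cintegral; apply/funext => t; ring.
  have := cdecayingM d2e (multiplier_cst (- rho)).
  by congr cdecaying; apply/funext => t; rewrite mulrC.
have ae12 : {ae mu, forall t, b1 t + b2 t * - rho = 0}.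
  apply: (fourier_zeros_ae0 dd (x := u + l)) => e /acc[n ne].
  exists (v n.+1 - v n - l); split => //.
  have -> : u + l + (v n.+1 - v n - l) = u + (v n.+1 - v n) by ring.
  by rewrite fE shift subrr.
have F12 y : fourier b1 y = rho * fourier b2 y.
  by apply/eqP; rewrite -subr_eq0 -fE; apply/eqP; exact: fourier_ae0.
exists rho.
  (* Substituting the proportionality into the identity at [u] and cancelling nonzero factors leaves
     [rho * conjc rho = 1]. *)
  have := prod 0%N u; rewrite !F12 conjcM mulrACA -sqr_normc.
  rewrite -[RHS]mul1r => /(mulIf _) H.
  have /eqP : `|rho| ^+ 2 = 1 by apply: H; rewrite mulf_neq0// conjc_eq0.
  by rewrite sqrp_eq1// => /eqP.
apply: filterS ae12; first exact: (ae_filter_ringOfSetsType mu).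
by move=> t /eqP; rewrite mulrN subr_eq0 mulrC => /eqP.
Qed.

End FourierUniqueness.

(** * The uniqueness theorem *)

Lemma gabor_moduli_fourier (R : realType) (f h : R -> R[i]) (alpha w : R) :
  0 < alpha -> L2_Rplus f -> L2_Rplus h ->
  (forall i : nat, `|gabor f (- (alpha * i%:R), w)| = `|gabor h (- (alpha * i%:R), w)|) ->
  let F := fourier (damp (2 * (2 * pi * alpha)) (gauss_half f)) in
  let H := fourier (damp (2 * (2 * pi * alpha)) (gauss_half h)) in
  forall u : R, F u * conjc (F (- u - 4 * pi * w)) = H u * conjc (H (- u - 4 * pi * w)).
Proof.
move=> alpha0 Lf Lh gab F H u.
have k0 : 0 < 2 * pi * alpha by rewrite !mulr_gt0 ?pi_gt0.
have dtwist g : L2_Rplus g -> cdecaying (fun t => gauss_half g t * expi (t * - (2 * pi * w))).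
  by move=> [Lg _]; apply: cdecayingM (cdecaying_gauss_half Lg) _; exact: multiplier_expi.
have twist g y : fourier (damp (2 * (2 * pi * alpha))
      (fun t => gauss_half g t * expi (t * - (2 * pi * w)))) y =
    fourier (damp (2 * (2 * pi * alpha)) (gauss_half g)) (- (2 * pi * w) + y).
  rewrite -fourier_shift; congr cintegral; apply/funext => t; rewrite /damp; ring.
have moduli i : `|cintegral (damp (i%:R * (2 * pi * alpha))
      (fun t => gauss_half f t * expi (t * - (2 * pi * w))))| =
    `|cintegral (damp (i%:R * (2 * pi * alpha))
      (fun t => gauss_half h t * expi (t * - (2 * pi * w))))|.
  have g0 : `|(gauss (alpha * i%:R))%:C| != 0 :> R[i].
    by rewrite normr_eq0 fmorph_eq0 gt_eqF// expR_gt0.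
  by apply: (mulfI g0); rewrite -!normrM -!gabor_laplace.
(* The twist by [w] shifts both frequencies by [- (2 pi w)]; evaluating at [u + 2 pi w] puts the
   whole displacement [4 pi w] into the second factor. *)
have := laplace_moduli_fourier k0 (dtwist f Lf) (dtwist h Lh) moduli (u + 2 * pi * w).
rewrite !twist.
have -> : - (2 * pi * w) + (u + 2 * pi * w) = u by ring.
by have -> : - (2 * pi * w) + - (u + 2 * pi * w) = - u - 4 * pi * w by ring.
Qed.

(** Otherwise the increments, being eventually smaller than [e], would all vanish from some index
    on; [p] would be a nonzero constant there, contradicting its limit. *)
Lemma increments_cluster (R : realType) (p : int -> R) :
  (forall n : int, p n != 0) -> p n @[n --> int_oo] --> 0 ->
  forall e : R, 0 < e -> exists n : nat, 0 < `|p n.+1 - p n| < e.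
Proof.
move=> p0 plim e e0.
have small d : 0 < d -> exists N, forall n : nat, (N <= n)%N -> `|p n| < d.
  move=> d0; have /cvgrPdist_lt/(_ _ d0)[N _ HN] := plim.
  by exists N => n Nn; have := HN n Nn; rewrite /= sub0r normrN.
have [N HN] := small _ (divr_gt0 e0 (ltr0Sn R 1)).
apply: contrapT => H.
have const n : p (N + n)%N = p N.
  elim: n => [|n IH]; first by rewrite addn0.
  rewrite -IH addnS; apply/eqP; rewrite -subr_eq0 -normr_le0 leNgt; apply/negP => gt0.
  apply: H; exists (N + n)%N; rewrite gt0 /=.
  have := HN (N + n)%N (leq_addr _ _); have := HN (N + n).+1 (leqW (leq_addr _ _)).
  by have := ler_normB (p (N + n).+1) (p (N + n)%N); lra.
have pN : 0 < `|p N| by rewrite normr_gt0.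
have [M HM] := small _ pN.
by have := HM (N + M)%N (leq_addl _ _); rewrite const ltxx.
Qed.

Theorem corollary1p4 (R : realType) (p : int -> R)
  (p_neq0 : forall n : int, p n != 0)
  (p_lim : p n @[n --> int_oo] --> 0)
  (alpha beta : R) (alpha_gt0 : 0 < alpha) (beta_gt0 : 0 < beta) :
  uniqueness_set L2_Rplus (dilate alpha Zset `*` dilate beta (Ztilde p)).
Proof.
move=> f h Lf Lh gab.
have mem_lattice (i n : nat) : (dilate alpha Zset `*` dilate beta (Ztilde p))
    (- (alpha * i%:R), beta * (n%:R + p n)).
  split => /=.
    exists (- i%:R); last by rewrite mulrN.
    by exists (- i%:Z) => //; rewrite rmorphN.
  by exists (n%:R + p n) => //; exists n%:Z.
have prod n := gabor_moduli_fourier alpha_gt0 Lf Lh (fun i => gab _ (mem_lattice i n)).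
have db g : L2_Rplus g -> cdecaying (damp (2 * (2 * pi * alpha)) (gauss_half g)).
  by move=> [Lg _]; exact/cdecaying_damp/cdecaying_gauss_half.
have k0 : 0 < 4 * pi * beta by rewrite !mulr_gt0 ?pi_gt0.
(* Consecutive differences are [4 pi beta (1 + p n.+1 - p n)], so they cluster at
   [l = 4 pi beta]. *)
have [|rho rho1 frho] := @fourier_product_phase R _ _
    (fun n => 4 * pi * (beta * (n%:R + p n))) (4 * pi * beta) (db f Lf) (db h Lh) prod.
  move=> e e0; have [n /andP[n0 ne]] := increments_cluster p_neq0 p_lim (divr_gt0 e0 k0).
  exists n.
  have -> : 4 * pi * (beta * (n.+1%:R + p n.+1)) - 4 * pi * (beta * (n%:R + p n)) -
      4 * pi * beta = (4 * pi * beta) * (p n.+1 - p n) by rewrite -natr1; ring.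
  by rewrite normrM (gtr0_norm k0) mulr_gt0// mulrC -ltr_pdivlMr.
exists rho => //; have [_ f0] := Lf; have [_ h0] := Lh.
have ae_filter := ae_filter_ringOfSetsType (@lebesgue_measure R).
(* For [t >= 0] the Gaussian and the damping are positive and can be divided out; for [t < 0] both
   functions vanish almost everywhere. *)
apply: filterS3 frho f0 h0 => t; rewrite /damp /gauss_half /= in_itv /= andbT.
case: ifP => [t0 + _ _|_ _ f0 h0]; last by rewrite f0// h0// mulr0.
have g0 : (gauss t)%:C * (expR (- (2 * (2 * pi * alpha)) * t))%:C != 0 :> R[i].
  by rewrite mulf_neq0// fmorph_eq0 gt_eqF// expR_gt0.
by move=> H; apply: (mulIf g0); rewrite (mulrA (f t)) H !mulrA.
Qed.
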